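(* Let $\ell\ge3$ be a fixed integer. There is a universal constant $d_0$ such that the following holds. Let $n\to\infty$ and let $p=p_n\in(0,1/2]$, $d=d_n$, $k=k_n\to\infty$ ($k\le n$) satisfy $d\ge d_0$ and $d\ge(5\log(1/p))^4$. If the global signed count of length-$\ell$ cycles $$f_\ell(G)=\sum_{H}\ \prod_{ij\in E(H)}(G_{ij}-p),$$ where $H$ ranges over all cycles of length $\ell$ in the complete graph on $[n]$, achieves strong separation between $\mathcal P=\mathcal G(n,p,d,k)$ and $\mathcal Q=\mathcal G(n,p)$, then $$d\ll\Big(\frac{k^2p\log(1/p)}{n}\Big)^{\ell/(\ell-2)}.$$
   Context: Graphs are on vertex set $[n]$ and $G_{ij}\in\{0,1\}$ denotes the indicator of edge $ij$. For $p\in(0,1)$, $\tau(p,d)$ is the number such that $\mathbb P(\langle U,U'\rangle\ge\tau(p,d))=p$ for independent $U,U'$ uniform on the unit sphere $\mathbb S^{d-1}\subset\mathbb R^d$. $\mathcal Q=\mathcal G(n,p)$ is the Erdős–Rényi distribution (edges independent with probability $p$). $\mathcal P=\mathcal G(n,p,d,k)$ is the following distribution: each $i\in[n]$ joins a hidden set $S$ independently with probability $k/n$; each $i\in S$ gets an independent $U_i$ uniform on $\mathbb S^{d-1}$; for $i\ne j$, if $i,j\in S$ then edge $ij$ is present iff $\langle U_i,U_j\rangle\ge\tau(p,d)$, otherwise edge $ij$ is present independently with probability $p$. A polynomial test statistic $f(G)$ achieves strong separation if, as $n\to\infty$, $$\mathbb E_{G\sim\mathcal P}[f(G)]-\mathbb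 E_{G\sim\mathcal Q}[f(G)]=\omega\Big(\sqrt{\mathrm{Var}_{G\sim\mathcal Q}[f(G)]}\vee\sqrt{\mathrm{Var}_{G\sim\mathcal P}[f(G)]}\Big),$$ where $a\vee b=\max(a,b)$ and $a_n=\omega(b_n)$ means $b_n/a_n\to0$. Also $a_n\ll b_n$ means $a_n/b_n\to0$. Asymptotics are as $n\to\infty$ with $k=k(n)\to\infty$. *)

(* Defs.v *)
From HB Require Import structures.
From mathcomp Require Import all_boot all_order all_algebra.
From mathcomp Require Import all_classical all_reals all_analysis.

Set Implicit Arguments.
Unset Strict Implicit.
Unset Printing Implicit Defensive.

Import Order.TTheory GRing.Theory Num.Theory.
Import numFieldNormedType.Exports.

Local Open Scope classical_set_scope.
Local Open Scope ring_scope.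

Section asymptotics.
Context {R : realType}.
Implicit Types a b : nat -> R.

(* b_n / a_n --> 0.  Since x / 0 = 0 in MathComp, the quotient is required to
   make sense eventually.  This is both "b << a" and "a = omega(b)"; as in the
   literal reading of b_n / a_n --> 0, no sign is imposed on a. *)
Definition much_less b a : Prop :=
  (\forall n \near \oo, a n != 0) /\ b n / a n @[n --> \oo] --> (0 : R).

End asymptotics.

(* The law of n independent samples of P, obtained by prepending to n samples
   an independent one. *)
Section power.
Context {R : realType} {d : measure_display} {T : measurableType d}.

Definition cons_pair n (x : T * n.-tuple T) : n.+1.-tuple T :=
  [the n.+1.-tuple T of x.1 :: x.2].

Lemma measurable_cons_pair n : measurable_fun setT (@cons_pair n).
Proof. by apply: measurable_cons; [exact: measurable_fst|exact: measurable_snd]. Qed.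

HB.instance Definition _ n :=
  isMeasurableFun.Build _ _ _ _ (@cons_pair n) (@measurable_cons_pair n).

Fixpoint power_prob (P : probability T R) n : probability (n.-tuple T) R :=
  match n with
  | 0 => \d_ [tuple]
  | m.+1 => distribution (P \x power_prob P m)%E (@cons_pair m)
  end.

Lemma power_prob_box (P : probability T R) n (A : 'I_n -> set T) :
  (forall i, measurable (A i)) ->
  power_prob P n [set x | forall i, A i (tnth x i)] = (\prod_i P (A i))%E.
Proof.
elim: n A => [|n IHn] A mA.
  by rewrite big_ord0 /= diracE mem_set// => -[].
have mB : measurable [set x : n.-tuple T |
    forall i, A (lift ord0 i) (tnth x i)].
  rewrite (_ : mkset _ = \big[setI/setT]_(i < n)
      ((fun x : n.-tuple T => tnth x i) @^-1` A (lift ord0 i))).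
    apply: bigsetI_measurable => i _; rewrite -[X in measurable X]setTI.
    exact: measurable_tnth.
  apply/seteqP; split=> [x Ax|x].
    apply: (big_ind (fun X : set _ => X x)) => // i _.
    exact: Ax.
  by move=> Bx i; move: Bx; rewrite (bigD1 i)//= => -[].
rewrite big_ord_recl /= -IHn// -product_measure1E// /distribution /pushforward /=.
congr product_measure1; apply/seteqP; split=> [[x y]/= Ax|[x y]/= [Ax Ay] i].
  by split=> [|i]; [exact: Ax ord0|have := Ax (lift ord0 i); rewrite tnthS].
have [j ->|->//] := unliftP ord0 i.
by rewrite tnthS; exact: Ay.
Qed.

End power.

Section sphere.
Context {R : realType} (d : nat).
Implicit Types x y : d.-tuple R.

Definition dot x y : R := \sum_(i < d) tnth x i * tnth y i.

Definition sphere : set (d.-tuple R) := [set x | dot x x = 1].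

Definition mxapp (M : 'M[R]_d) x : d.-tuple R :=
  [tuple \sum_(j < d) M i j * tnth x j | i < d].

(* The uniform distribution on the sphere: the Borel probability measure
   carried by the sphere and invariant under all orthogonal maps.  (The product
   sigma-algebra on d.-tuple R is the Borel sigma-algebra of R^d.) *)
Definition sphere_uniform (sigma : probability (d.-tuple R) R) : Prop :=
  sigma sphere = 1%E /\
  forall M : 'M[R]_d, M *m M^T = 1%:M ->
  forall A, measurable A -> sigma (mxapp M @^-1` A) = sigma A.

(* t = tau(p, d) when sigma is uniform on the sphere *)
Definition is_threshold (sigma : probability (d.-tuple R) R) (p t : R) : Prop :=
  (sigma \x sigma)%E [set u | t <= dot u.1 u.2] = p%:E.

End sphere.

(* A simple graph on 'I_n is its set of edges, a set of 2-element sets. *)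
Section graphs.
Variable n : nat.

Definition pairs : {set {set 'I_n}} := [set e : {set 'I_n} | #|e| == 2%N]%SET.

Definition graphs : {set {set {set 'I_n}}} := powerset pairs.

Definition cycle_edges l (t : l.-tuple 'I_n) : {set {set 'I_n}} :=
  [set [set tnth t i; tnth t (ordS i)] | i : 'I_l]%SET.

(* the cycles of length l of the complete graph, as subgraphs (for 3 <= l) *)
Definition cycles l : {set {set {set 'I_n}}} :=
  [set cycle_edges t | t : l.-tuple 'I_n & uniq t]%SET.

End graphs.

(* A law on graphs is given by its mass function on [graphs n]. *)
Section laws.
Context {R : realType} (n : nat).
Implicit Types (m f : {set {set 'I_n}} -> R) (G : {set {set 'I_n}}).

Definition expect m f : R := \sum_(G in graphs n) m G * f G.

Definition variance m f : R := expect m (fun G => (f G - expect m f) ^+ 2).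

(* independent edges, e being present with probability q e *)
Definition indep_edges (q : {set 'I_n} -> R) G : R :=
  \prod_(e in pairs n) (if e \in G then q e else 1 - q e).

Definition ER (p : R) : {set {set 'I_n}} -> R := indep_edges (fun=> p).

(* Conditional probability of the edge e given S and the latent vectors: inside
   S it is the indicator of <U_i, U_j> >= t. *)
Definition edge_prob d (p t : R) (S : {set 'I_n}) (U : n.-tuple (d.-tuple R))
    (e : {set 'I_n}) : R :=
  if e \subset S then
    [forall i in e, forall j in e,
       (i != j) ==> (t <= dot (tnth U i) (tnth U j))]%:R
  else p.

(* G(n,p,d,k), for sigma uniform on the sphere and t = tau(p, d): average over
   S and U of the conditional law of the edges.  A latent vector is drawn for
   every vertex; those outside S are not used. *)
Definition planted d (sigma : probability (d.-tuple R) R) (p t k : R) G : R :=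
  \sum_(S : {set 'I_n})
    (\prod_(i < n) (if i \in S then k / n%:R else 1 - k / n%:R)) *
    \int[power_prob sigma n]_(U in setT) indep_edges (edge_prob p t S U) G.

Definition signed_cycle_count l (p : R) G : R :=
  \sum_(H in cycles n l) \prod_(e in H) ((e \in G)%:R - p).

End laws.

Definition strong_separation {R : realType}
    (P Q f : forall n, {set {set 'I_n}} -> R) : Prop :=
  much_less
    (fun n => Num.max (Num.sqrt (variance (Q n) (f n)))
                      (Num.sqrt (variance (P n) (f n))))
    (fun n => expect (P n) (f n) - expect (Q n) (f n)).

(* Main.v *)
(* Write W(x, y) = 1{<x, y> >= tau} - p and let T be the integral operator on the
   sphere with kernel W.  The expectation of the signed cycle count under P is
   (number of cycles) (k / n)^l K with K = tr T^l, while its variance under Q is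
   (number of cycles) (p (1 - p))^l and there are at most n^l cycles.  So it is
   enough to show |K| <= C_l p^l ln(1/p)^(l/2) d^(1 - l/2).

   All kernels of powers of T depend on the inner product <x, z> only.  Let
   th^2 = ln(1/p) / d.  Averaging x over sign vectors shows that <x, U> is
   subgaussian, so conditionally on any event of probability at least p^2 it is of
   order th.  An integration by parts (obtained from rotations by a small angle)
   bounds the mass of a thin strip inside a cap, hence the derivative of the
   measure of the intersection of two caps: the kernel of T^2 is, up to an
   exponentially small error, C ln(1/p) p^2-Lipschitz in <x, z> near
   orthogonality.  A further application of T moves a point y of the cap around z
   by <x - x', y>, which is of order th |x - x'|, so it multiplies the Lipschitz
   constant by C th p.  Since the kernels have mean zero, their value at an
   orthogonal pair is small as well, and l - 2 steps give
   |K| <= C_l ln(1/p) th^(l - 2) p^l = C_l p^l ln(1/p)^(l/2) d^(1 - l/2). *)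
Require Import Defs.
From mathcomp Require Import all_boot all_order all_algebra.
From mathcomp Require Import all_classical all_reals all_analysis.
From mathcomp Require Import measurable_realfun.
From mathcomp Require Import ring lra zify.
Import Order.TTheory GRing.Theory Num.Theory.
Import numFieldNormedType.Exports.
Set Implicit Arguments.
Unset Strict Implicit.
Unset Printing Implicit Defensive.
Local Open Scope classical_set_scope.
Local Open Scope ring_scope.

(** * Expectations of bounded measurable functions *)

(** About [sigma] only orthogonal invariance is known, not a density. So every change of variables
    on the sphere is an exchange of tuples of vectors with equal Gram matrices.

    The Lipschitz argument cannot begin with T, whose kernel is a discontinuous indicator. For T^2
    the strip estimate bounds the difference of two intersection measures by L |a - b| times these
    measures themselves, where L = ln(1/p) and a, b are the inner products. It closes only if L |a -
    b| is below a constant, which forces a radius [dl] = 1 / (4800 L) of near orthogonality. A point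
    falls outside this radius with probability at most 2 [eta], [eta] = exp(- d dl^2 / 8), and there
    only the crude bound (2 p)^j on the kernels is left.

    This is where d >= (5 L)^4 enters: it gives d / L^2 >= 25 sqrt d, so that, for d >= d0, [eta] is
    at most p^2 exp(- c sqrt d) for a numerical c > 0. This beats every power of d, and the far
    points only change constants. The constants that depend on l enter C alone, so d0 does not
    depend on l. *)

Section bounded_measurable.
Context {R : realType} {dT : measure_display} {T : measurableType dT}.
Implicit Types (D : set T) (f g : T -> R) (b : T -> bool).

(** Measurability is global but boundedness is asked on D only: inner products are unbounded on R^d
    and bounded on the sphere, which carries all the mass. *)
Definition bmfun D f :=
  measurable_fun setT f /\ exists M, forall x, D x -> `|f x| <= M.

Lemma bmfun_cst D c : bmfun D (fun=> c).
Proof. by split; [exact: measurable_cst|exists `|c|]. Qed.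

Lemma bmfunD D f g : bmfun D f -> bmfun D g -> bmfun D (fun x => f x + g x).
Proof.
move=> [mf [M fM]] [mg [N gN]]; split; first exact: measurable_funD.
by exists (M + N) => x Dx; rewrite (le_trans (ler_normD _ _))// lerD// ?fM ?gN.
Qed.

Lemma bmfunN D f : bmfun D f -> bmfun D (fun x => - f x).
Proof.
move=> [mf [M fM]]; split; first exact: measurableT_comp.
by exists M => x Dx; rewrite normrN fM.
Qed.

Lemma bmfunM D f g : bmfun D f -> bmfun D g -> bmfun D (fun x => f x * g x).
Proof.
move=> [mf [M fM]] [mg [N gN]]; split; first exact: measurable_funM.
by exists (M * N) => x Dx; rewrite normrM ler_pM// ?fM ?gN.
Qed.

Lemma bmfunX D f n : bmfun D f -> bmfun D (fun x => f x ^+ n).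
Proof.
move=> bf; elim: n => [|n IHn]; first exact: bmfun_cst.
by rewrite (_ : (fun x => _) = fun x => f x * f x ^+ n);
  [exact: bmfunM|apply/funext => x; rewrite exprS].
Qed.

Lemma bmfun_norm D f : bmfun D f -> bmfun D (fun x => `|f x|).
Proof.
move=> [mf [M fM]]; split; first exact: measurableT_comp.
by exists M => x Dx; rewrite normr_id fM.
Qed.

Lemma bmfun_min D f g :
  bmfun D f -> bmfun D g -> bmfun D (fun x => Num.min (f x) (g x)).
Proof.
move=> [mf [M fM]] [mg [N gN]]; split; first exact: measurable_minr.
exists (Num.max M N) => x Dx; rewrite /Num.min.
by case: ifP => _; rewrite le_max ?fM ?gN ?orbT.
Qed.

Lemma bmfun_max D f g :
  bmfun D f -> bmfun D g -> bmfun D (fun x => Num.max (f x) (g x)).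
Proof.
move=> [mf [M fM]] [mg [N gN]]; split; first exact: measurable_maxr.
exists (Num.max M N) => x Dx; rewrite /Num.max.
by case: ifP => _; rewrite le_max ?fM ?gN ?orbT.
Qed.

Lemma bmfun_expR D f : bmfun D f -> bmfun D (fun x => expR (f x)).
Proof.
move=> [mf [M fM]]; split.
  by apply: measurableT_comp => //; exact: measurable_expR.
exists (expR M) => x Dx; rewrite ger0_norm ?expR_ge0// ler_expR.
by rewrite (le_trans (ler_norm _))// fM.
Qed.

Lemma bmfun_ind D b : measurable_fun setT b -> bmfun D (fun x => (b x)%:R).
Proof.
move=> mb; split.
  rewrite (_ : (fun x => _) = fun x => if b x then 1 else 0); last first.
    by apply/funext => x; case: (b x).
  by apply: measurable_fun_ifT => //; exact: measurable_cst.
by exists 1 => x _; case: (b x); rewrite ?normr0 ?normr1.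
Qed.

Lemma bmfun_sum D I (s : seq I) (F : I -> T -> R) :
  (forall i, bmfun D (F i)) -> bmfun D (fun x => \sum_(i <- s) F i x).
Proof.
move=> bF; elim: s => [|i s IHs].
  by under eq_fun do rewrite big_nil; exact: bmfun_cst.
by under eq_fun do rewrite big_cons; exact: bmfunD.
Qed.

Lemma bmfun_prod D I (s : seq I) (F : I -> T -> R) :
  (forall i, bmfun D (F i)) -> bmfun D (fun x => \prod_(i <- s) F i x).
Proof.
move=> bF; elim: s => [|i s IHs].
  by under eq_fun do rewrite big_nil; exact: bmfun_cst.
by under eq_fun do rewrite big_cons; exact: bmfunM.
Qed.

Lemma bmfunW D D' f : D' `<=` D -> bmfun D f -> bmfun D' f.
Proof. by move=> DD' [mf [M fM]]; split => //; exists M => x /DD' /fM. Qed.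

Lemma bmfunT D f : bmfun setT f -> bmfun D f.
Proof. exact: bmfunW. Qed.

End bounded_measurable.

Lemma bmfun_comp {R : realType} {dS dT : measure_display}
    {S : measurableType dS} {T : measurableType dT} (f : T -> R) (phi : S -> T)
    (D : set S) :
  measurable_fun setT phi -> bmfun setT f -> bmfun D (fun x => f (phi x)).
Proof.
move=> mphi [mf [M fM]]; split; first exact: measurableT_comp.
by exists M => x _; exact: fM.
Qed.

Ltac mbool := repeat first
  [ assumption
  | apply: measurable_and | apply: measurable_or
  | apply: measurable_fun_ler | apply: measurable_fun_ltr
  | exact: measurable_cst ].

Ltac bmf := repeat first
  [ assumption
  | apply: bmfun_cst | apply: bmfunD | apply: bmfunN | apply: bmfunM
  | apply: bmfunX | apply: bmfun_norm | apply: bmfun_min | apply: bmfun_max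
  | apply: bmfun_expR | apply: bmfun_ind; mbool ].

Section expectation.
Context {R : realType} {dT : measure_display} {T : measurableType dT}.
Variables (P : probability T R) (D : set T).
Hypotheses (mD : measurable D) (PD : P D = 1%E).
Implicit Types (f g : T -> R).

Local Notation E f := (Rintegral P D f).

Lemma bmfun_integrable f : bmfun D f -> P.-integrable D (EFin \o f).
Proof.
move=> [mf [M fM]]; apply: measurable_bounded_integrable => //.
- by change (P D < +oo)%E; rewrite PD ltey.
- exact: measurable_funTS.
- by exists M; split; [exact: num_real|move=> N MN x Dx /=; rewrite (le_trans (fM _ Dx))// ltW].
Qed.
Let bi := bmfun_integrable.

Lemma eq_Ex f g : (forall x, D x -> f x = g x) -> E f = E g.
Proof. by move=> fg; apply: eq_Rintegral => x /set_mem; exact: fg. Qed.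

Lemma Ex_cst c : E (fun=> c) = c.
Proof. by rewrite Rintegral_cst// (_ : fine _ = 1) ?mulr1//; change (fine (P D) = 1); rewrite PD. Qed.

Lemma ExD f g : bmfun D f -> bmfun D g -> E (fun x => f x + g x) = E f + E g.
Proof. by move=> bf bg; rewrite RintegralD//; exact: bi. Qed.

Lemma ExB f g : bmfun D f -> bmfun D g -> E (fun x => f x - g x) = E f - E g.
Proof. by move=> bf bg; rewrite RintegralB//; exact: bi. Qed.

Lemma ExZl c f : bmfun D f -> E (fun x => c * f x) = c * E f.
Proof. by move=> bf; rewrite RintegralZl//; exact: bi. Qed.

Lemma ExZr c f : bmfun D f -> E (fun x => f x * c) = E f * c.
Proof. by move=> bf; rewrite RintegralZr//; exact: bi. Qed.

Lemma Ex_le f g : bmfun D f -> bmfun D g ->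
  (forall x, D x -> f x <= g x) -> E f <= E g.
Proof. by move=> bf bg fg; apply: le_Rintegral => //; exact: bi. Qed.

Lemma Ex_ge0 f : (forall x, D x -> 0 <= f x) -> 0 <= E f.
Proof. exact: Rintegral_ge0. Qed.

Lemma Ex_le_cst f c : bmfun D f -> (forall x, D x -> f x <= c) -> E f <= c.
Proof. by move=> bf fc; rewrite -(Ex_cst c) Ex_le//; exact: bmfun_cst. Qed.

Lemma Ex_norm f : bmfun D f -> `|E f| <= E (fun x => `|f x|).
Proof. by move=> bf; apply: le_normr_Rintegral => //; exact: bi. Qed.

Lemma Ex_sum I (s : seq I) (F : I -> T -> R) : (forall i, bmfun D (F i)) ->
  E (fun x => \sum_(i <- s) F i x) = \sum_(i <- s) E (F i).
Proof.
move=> bF; elim: s => [|i s IHs].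
  by rewrite big_nil -[RHS]Ex_cst; apply: eq_Ex => x _; rewrite big_nil.
rewrite big_cons -IHs -ExD//; last exact: bmfun_sum.
by apply: eq_Ex => x _; rewrite big_cons.
Qed.

(** D has full measure. The model and Fubini use integrals over the whole space, the estimates use
    integrals over the sphere. *)
Lemma Ex_setT f : bmfun setT f -> \int[P]_x f x = E f.
Proof.
move=> bf; rewrite [RHS]Rintegral_mkcond.
have PDC : P (~` D) = 0%E by rewrite probability_setC// PD subee.
congr fine; apply: ae_eq_integral => //.
- by case: bf => mf _; exact/measurable_EFinP.
- apply/measurable_EFinP/(measurable_restrict _ _ _).1 => //.
  by apply: measurable_funTS; case: bf.
- exists (~` D); split => //; first exact: measurableC.
  by move=> x /=; apply: contra_not => Dx _; rewrite patchE mem_set.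
Qed.

End expectation.

(** * Iterated integrals of bounded functions *)

Section product_integral.
Context {R : realType} {d1 d2 : measure_display}.
Context {X : measurableType d1} {Y : measurableType d2}.
Implicit Types (F : X * Y -> R) (P : probability X R) (Q : probability Y R).

Lemma bmfun_pair1 F x (D : set Y) : bmfun setT F -> bmfun D (fun y => F (x, y)).
Proof. by move=> bF; apply: (@bmfun_comp _ _ _ _ _ F (pair x)) => //; exact: measurable_pair1. Qed.

Lemma bmfun_pair2 F y (D : set X) : bmfun setT F -> bmfun D (fun x => F (x, y)).
Proof. by move=> bF; apply: (@bmfun_comp _ _ _ _ _ F (fun x => (x, y))) => //; exact: measurable_pair2. Qed.

Lemma Rintegral_bounded {d0} {T : measurableType d0} (P : probability T R) f M :
  bmfun setT f -> (forall x, `|f x| <= M) -> `|\int[P]_x f x| <= M.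
Proof.
move=> bf fM; apply: le_trans (Ex_norm _ _ bf) _ => //; first exact: probability_setT.
by apply: Ex_le_cst => //; [exact: probability_setT|bmf].
Qed.

Lemma bmfun_Rintegral Q F :
  bmfun setT F -> bmfun setT (fun x => \int[Q]_y F (x, y)).
Proof.
move=> bF; have [mF [M FM]] := bF; split; last first.
  by exists M => x _; apply: Rintegral_bounded; [exact: bmfun_pair1|move=> y; exact: FM].
have bFM : bmfun setT (fun z => F z + M) by bmf.
(* Adding M makes the integrand nonnegative, as Tonelli's measurability statement requires. *)
rewrite (_ : (fun x => _) =
    fun x => fine (\int[Q]_y ((F (x, y) + M)%:E))%E - M); last first.
  apply/funext => x; rewrite -/(Rintegral Q setT (fun y => F (x, y) + M)).
  have QT := probability_setT Q.
  rewrite ExD ?Ex_cst ?addrK//; [exact: bmfun_pair1|exact: bmfun_cst].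
apply: measurable_funB => //; apply: measurableT_comp => //.
apply: (measurable_fun_fubini_tonelli_F (m2 := Q) (fun z => (F z + M)%:E)) => /=.
  by apply/measurable_EFinP; case: bFM.
by move=> z; rewrite lee_fin -lerBlDr sub0r lerNl (le_trans _ (FM z I))// ler_normr lexx orbT.
Qed.

Lemma bmfun_swap F : bmfun setT F -> bmfun setT (fun z : Y * X => F (z.2, z.1)).
Proof.
by move=> bF; apply: (@bmfun_comp _ _ _ _ _ F (fun z => (z.2, z.1))) => //; exact: measurable_fun_pair.
Qed.

Let integrable_prod P Q F : bmfun setT F ->
  ((P \x Q)%E : {measure set _ -> \bar R}).-integrable setT (EFin \o F).
Proof. by move=> bF; apply: bmfun_integrable => //; exact: probability_setT. Qed.

Lemma Rintegral_prod P Q F : bmfun setT F ->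
  \int[(P \x Q)%E]_z F z = \int[P]_x \int[Q]_y F (x, y).
Proof.
move=> bF; rewrite {1}/Rintegral -(integral12_prod_meas1 (integrable_prod _ _ bF)).
congr fine; apply: eq_integral => x _; rewrite fineK// -/(fubini_F _ _ _).
apply: integrable_fin_num => //.
apply: (bmfun_integrable (D := setT)) => //; first exact: probability_setT.
exact: bmfun_pair1.
Qed.

Lemma Rintegral_Fubini P Q F : bmfun setT F ->
  \int[P]_x \int[Q]_y F (x, y) = \int[Q]_y \int[P]_x F (x, y).
Proof.
move=> bF; rewrite -Rintegral_prod// {1}/Rintegral.
rewrite -(integral21_prod_meas1 (integrable_prod _ _ bF)).
congr fine; apply: eq_integral => y _; rewrite fineK// -/(fubini_G _ _ _).
apply: integrable_fin_num => //.
apply: (bmfun_integrable (D := setT)) => //; first exact: probability_setT.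
exact: bmfun_pair2.
Qed.

End product_integral.

(** * Integrals over independent samples *)

Section power_prob_integral.
Context {R : realType} {d : measure_display} {T : measurableType d}.
Variable P : probability T R.

Lemma bmfun_Rintegral_param {d'} {X : measurableType d'} (Q : probability T R)
    (F : X -> T -> R) :
  bmfun setT (fun z : X * T => F z.1 z.2) -> bmfun setT (fun x => \int[Q]_y F x y).
Proof. exact: (bmfun_Rintegral Q (F := fun z => F z.1 z.2)). Qed.

Lemma Rintegral_power_probS n (F : n.+1.-tuple T -> R) : bmfun setT F ->
  \int[power_prob P n.+1]_U F U =
  \int[P]_x \int[power_prob P n]_V F (cons_pair (x, V)).
Proof.
move=> bF; rewrite -(Rintegral_prod P (power_prob P n) (F := F \o @cons_pair _ T n)).
  rewrite /Rintegral /= /distribution; congr fine.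
  have bFc : bmfun setT (F \o @cons_pair _ T n).
    by apply: (@bmfun_comp _ _ _ _ _ F (@cons_pair _ T n)) => //; exact: measurable_cons_pair.
  rewrite integral_pushforward//.
  - by apply/measurable_EFinP; case: bF.
  - rewrite preimage_setT; apply: (bmfun_integrable (D := setT)) bFc => //.
    exact: probability_setT.
by apply: (@bmfun_comp _ _ _ _ _ F (@cons_pair _ T n)) => //; exact: measurable_cons_pair.
Qed.

Definition upd n (U : n.-tuple T) (i : 'I_n) (y : T) : n.-tuple T :=
  [tuple if j == i then y else tnth U j | j < n].

Lemma tnth_upd n (U : n.-tuple T) i y j :
  tnth (upd U i y) j = if j == i then y else tnth U j.
Proof. by rewrite tnth_mktuple. Qed.

Lemma measurable_upd n (i : 'I_n) :
  measurable_fun setT (fun z : n.-tuple T * T => upd z.1 i z.2).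
Proof.
apply/measurable_fun_tnthP => j.
rewrite (_ : _ \o _ = fun z : n.-tuple T * T => if j == i then z.2 else tnth z.1 j).
  case: eqP => _; first exact: measurable_snd.
  by apply: (measurableT_comp (f := fun x : n.-tuple T => tnth x j)); [exact: measurable_tnth|exact: measurable_fst].
by apply/funext => z /=; rewrite tnth_upd.
Qed.

Lemma upd_cons0 n x (V : n.-tuple T) y :
  upd (cons_pair (x, V)) ord0 y = cons_pair (y, V).
Proof.
apply: eq_from_tnth => j; rewrite tnth_upd.
have [->|] := eqVneq j ord0; first by rewrite !tnth0.
by case: (unliftP ord0 j) => [k ->|->]; rewrite ?eqxx// !tnthS.
Qed.

Lemma upd_consS n x (V : n.-tuple T) i y :
  upd (cons_pair (x, V)) (lift ord0 i) y = cons_pair (x, upd V i y).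
Proof.
apply: eq_from_tnth => j; rewrite tnth_upd.
case: (unliftP ord0 j) => [k ->|->]; last by rewrite !tnth0.
by rewrite !tnthS tnth_upd (inj_eq lift_inj).
Qed.

(** Redrawing one sample independently preserves the law; this later integrates out the vertices of
    a cycle one at a time. *)
Lemma Rintegral_resample n (i : 'I_n) (F : n.-tuple T -> R) : bmfun setT F ->
  \int[power_prob P n]_U F U = \int[power_prob P n]_U \int[P]_y F (upd U i y).
Proof.
elim: n i F => [[]//|n IHn] i F bF.
have bFc : bmfun setT (F \o @cons_pair _ T n).
  by apply: (@bmfun_comp _ _ _ _ _ F (@cons_pair _ T n)) => //; exact: measurable_cons_pair.
have bU j : bmfun setT (fun z : n.+1.-tuple T * T => F (upd z.1 j z.2)).
  by apply: (@bmfun_comp _ _ _ _ _ F (fun z => upd z.1 j z.2)) => //; exact: measurable_upd.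
rewrite !Rintegral_power_probS//; last exact: bmfun_Rintegral_param.
case: (unliftP ord0 i) => [j ->|->].
  apply: eq_Rintegral => x _; rewrite (IHn j); last first.
    exact: (bmfun_pair1 (F := F \o @cons_pair _ T n)).
  apply: eq_Rintegral => V _; apply: eq_Rintegral => y _.
  by rewrite upd_consS.
(* At index 0 the outer variable is overwritten, so its integral is that of a constant; the other
   two integrals are exchanged. *)
transitivity (\int[P]_x (\int[power_prob P n]_V \int[P]_y F (cons_pair (y, V)))).
  rewrite Ex_cst//; last exact: probability_setT.
  exact: (Rintegral_Fubini P (power_prob P n) (F := F \o @cons_pair _ T n)).
apply: eq_Rintegral => x _; apply: eq_Rintegral => V _; apply: eq_Rintegral => y _.
by rewrite upd_cons0.
Qed.

End power_prob_integral.

(** * Orthogonal maps and Gram matrices *)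

Section gram.
Context {R : realType} (d : nat).
Implicit Types x y z : d.-tuple R.

Definition lincomb (a : R) x (b : R) y : d.-tuple R :=
  [tuple a * tnth x i + b * tnth y i | i < d].

Lemma dotC x y : dot x y = dot y x.
Proof. by apply: eq_bigr => i _; rewrite mulrC. Qed.

Lemma dot_lincombl a x b y z :
  dot (lincomb a x b y) z = a * dot x z + b * dot y z.
Proof.
rewrite /dot !mulr_sumr -big_split/=; apply: eq_bigr => i _.
by rewrite tnth_mktuple mulrDl !mulrA.
Qed.

Lemma dot_lincombr a x b y z :
  dot z (lincomb a x b y) = a * dot z x + b * dot z y.
Proof. by rewrite dotC dot_lincombl !(dotC z). Qed.

Lemma dot_ge0 x : 0 <= dot x x.
Proof. by apply: sumr_ge0 => i _; rewrite -expr2 sqr_ge0. Qed.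

Lemma dot_eq0 x : dot x x = 0 -> forall i, tnth x i = 0.
Proof.
move=> x0 i; apply/eqP; rewrite -sqrf_eq0 expr2; apply/eqP/(psumr_eq0P _ x0) => // j _.
by rewrite -expr2 sqr_ge0.
Qed.

Lemma cauchy_schwarz_unit x y : dot x x = 1 -> dot y y = 1 -> `|dot x y| <= 1.
Proof.
move=> x1 y1; rewrite ler_norml.
have := dot_ge0 (lincomb 1 x 1 y); have := dot_ge0 (lincomb 1 x (-1) y).
rewrite !(dot_lincombl, dot_lincombr) x1 y1 (dotC y x); lra.
Qed.

Definition orthogonal_mx (M : 'M[R]_d) := M *m M^T = 1%:M.

Lemma orthogonal_mxM M N :
  orthogonal_mx M -> orthogonal_mx N -> orthogonal_mx (M *m N).
Proof.
move=> OM ON; rewrite /orthogonal_mx trmx_mul mulmxA -(mulmxA M) ON.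
by rewrite mulmx1.
Qed.

Lemma mxappE M x : \col_i tnth (mxapp M x) i = M *m (\col_i tnth x i).
Proof.
apply/matrixP => i j; rewrite !mxE tnth_mktuple.
by apply: eq_bigr => k _; rewrite mxE.
Qed.

Lemma dotE x y : (dot x y)%:M = (\col_i tnth x i)^T *m (\col_i tnth y i) :> 'M[R]_1.
Proof.
apply/matrixP => i j; rewrite !mxE !ord1 eqxx mulr1n.
by apply: eq_bigr => k _; rewrite !mxE.
Qed.

Lemma dot_mxapp M x y : orthogonal_mx M -> dot (mxapp M x) (mxapp M y) = dot x y.
Proof.
move=> OM; apply/eqP; rewrite -subr_eq0; apply/eqP.
have : (dot (mxapp M x) (mxapp M y))%:M = (dot x y)%:M :> 'M[R]_1.
  by rewrite !dotE !mxappE trmx_mul mulmxA -(mulmxA _ M^T) (mulmx1C OM) mulmx1.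
by move=> /matrixP/(_ ord0 ord0); rewrite !mxE eqxx !mulr1n => ->; rewrite subrr.
Qed.

Lemma mxapp_inj x y : \col_i tnth x i = \col_i tnth y i -> x = y.
Proof.
by move=> /matrixP xy; apply: eq_from_tnth => i; have := xy i ord0; rewrite !mxE.
Qed.

Lemma mxappM M N x : mxapp (M *m N) x = mxapp M (mxapp N x).
Proof. by apply: mxapp_inj; rewrite !mxappE mulmxA. Qed.

Definition householder (v : d.-tuple R) : 'M[R]_d :=
  1%:M - (2 / dot v v) *: ((\col_i tnth v i) *m (\col_i tnth v i)^T).

Lemma householderE v x :
  mxapp (householder v) x = lincomb 1 x (- (2 / dot v v * dot v x)) v.
Proof.
apply: mxapp_inj; rewrite mxappE mulmxBl mul1mx -scalemxAl -mulmxA -dotE.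
rewrite mul_mx_scalar scalerA; apply/matrixP => i j.
by rewrite !mxE tnth_mktuple mul1r mulNr.
Qed.

Lemma orthogonal_householder v : dot v v != 0 -> orthogonal_mx (householder v).
Proof.
move=> v0; rewrite /orthogonal_mx /householder; set c := \col_i _.
set k := 2 / _; have -> : (1%:M - k *: (c *m c^T))^T = 1%:M - k *: (c *m c^T).
  by apply/matrixP => i j; rewrite !mxE eq_sym; congr (_ - _ * _); apply: eq_bigr => l _; rewrite !mxE mulrC.
rewrite mulmxBl mul1mx mulmxBr mulmx1.
rewrite -scalemxAl -scalemxAr -mulmxA (mulmxA c^T) -dotE mul_scalar_mx.
rewrite -scalemxAr !scalerA divfK//; apply/matrixP => i j.
by rewrite !mxE; ring.
Qed.

(** Induction: if M is right on the first n vectors, the reflection taking M x_n to x'_n fixes the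
    earlier x'_i, because these have the same inner product with M x_n and with x'_n. *)
Lemma gram_orthogonal n (x x' : nat -> d.-tuple R) :
  (forall i j, (i < n)%N -> (j < n)%N -> dot (x i) (x j) = dot (x' i) (x' j)) ->
  exists2 M, orthogonal_mx M & forall i, (i < n)%N -> mxapp M (x i) = x' i.
Proof.
elim: n => [|n IHn] xx'.
  by exists 1%:M => //; rewrite /orthogonal_mx trmx1 mulmx1.
have [i j ni nj|M OM Mx] := IHn; first by rewrite xx' // ltnS ltnW.
set a := mxapp M (x n); set v := lincomb 1 a (-1) (x' n).
have aa : dot a a = dot (x' n) (x' n) by rewrite dot_mxapp// xx'.
have [v0|v0] := eqVneq (dot v v) 0.
  exists M => // i; rewrite ltnS leq_eqVlt => /predU1P[->|/Mx//].
  apply: eq_from_tnth => k; have := dot_eq0 v0 k; rewrite tnth_mktuple => H.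
  by rewrite -/a; move: H; rewrite mul1r mulN1r => /eqP; rewrite subr_eq0 => /eqP.
exists (householder v *m M); first exact/orthogonal_mxM/OM/orthogonal_householder.
move=> i; rewrite ltnS leq_eqVlt mxappM householderE => /predU1P[->|ni].
  rewrite -/a; have -> : 2 / dot v v * dot v a = 1.
    have -> : 2 / dot v v * dot v a = (2 * dot v a) / dot v v by ring.
    have -> : 2 * dot v a = dot v v; last by rewrite divff.
    by rewrite !(dot_lincombl, dot_lincombr) aa (dotC (x' n) a); ring.
  by apply: eq_from_tnth => k; rewrite !tnth_mktuple; ring.
rewrite Mx//; have -> : dot v (x' i) = 0.
  rewrite dot_lincombl -{1}(Mx i)// dot_mxapp// xx'// 1?ltnS 1?ltnW//; ring.
by apply: eq_from_tnth => k; rewrite !tnth_mktuple; ring.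
Qed.

Lemma measurable_dot {d'} {T : measurableType d'} (f g : T -> d.-tuple R) :
  measurable_fun setT f -> measurable_fun setT g ->
  measurable_fun setT (fun t => dot (f t) (g t)).
Proof.
move=> mf mg; apply: measurable_sum => i.
have mt := @measurable_tnth _ R d i.
by apply: measurable_funM;
  [apply: (measurableT_comp mt mf)|apply: (measurableT_comp mt mg)].
Qed.

Lemma measurable_sphere : measurable (@sphere R d).
Proof.
have md : measurable_fun setT (fun x : d.-tuple R => dot x x) by exact: measurable_dot.
rewrite (_ : @sphere R d = setT `&` (fun x : d.-tuple R => dot x x) @^-1` [set 1]).
  by apply: md => //; exact: measurable_set1.
by rewrite setTI.
Qed.

Lemma measurable_mxapp (M : 'M[R]_d) : measurable_fun setT (mxapp M).
Proof.
apply/measurable_fun_tnthP => i.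
rewrite (_ : _ \o _ = fun x => \sum_(j < d) M i j * tnth x j); last first.
  by apply/funext => x; rewrite /= tnth_mktuple.
apply: measurable_sum => j; apply: measurable_funM; first exact: measurable_cst.
exact: measurable_tnth.
Qed.

End gram.

(** * The uniform distribution on the sphere *)

Lemma expR_ge_sqr {R : realType} (w : R) : 0 <= w -> w ^+ 2 <= 4 * expR w.
Proof.
move=> w0; have h : 0 <= 1 + w / 2 <= expR (w / 2).
  by rewrite expR_ge1Dx andbT addr_ge0// divr_ge0.
have -> : expR w = expR (w / 2) ^+ 2 by rewrite -expRM_natl; congr expR; field.
nra.
Qed.

(** The exponent 2 a^2, weaker than the sharp a^2 / 2, permits an elementary proof: for |a| >= 1/2
    it dominates |a|, and for smaller |a| one has exp(a) <= 1 / (1 - a). *)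
Lemma cosh_le {R : realType} (a : R) : expR a + expR (- a) <= 2 * expR (2 * a ^+ 2).
Proof.
have [a1|a1] := leP (1 / 2) `|a|.
  have h x : `|x| = `|a| -> expR x <= expR (2 * a ^+ 2).
    move=> xa; rewrite ler_expR (le_trans (ler_norm _))// xa -real_normK ?num_real//.
    by have := normr_ge0 a; nra.
  have := h a erefl; have := h (- a) (normrN _); lra.
have /andP[a2 a3] : - (1 / 2) < a < 1 / 2 by rewrite -ltr_norml.
have h1 : expR a <= (1 - a)^-1.
  rewrite -[leLHS]invrK -expRN lef_pV2 ?posrE ?expR_gt0//; last lra.
  exact: expR_ge1Dx.
have h2 : expR (- a) <= (1 + a)^-1.
  rewrite -[leLHS]invrK -expRN opprK lef_pV2 ?posrE ?expR_gt0//; last lra.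
  exact: expR_ge1Dx.
have h3 : 1 + 2 * a ^+ 2 <= expR (2 * a ^+ 2) by exact: expR_ge1Dx.
have h4 : (1 - a)^-1 + (1 + a)^-1 <= 2 * (1 + 2 * a ^+ 2).
  have -> : (1 - a)^-1 + (1 + a)^-1 = 2 / (1 - a ^+ 2).
    by field; rewrite !gt_eqF//; nra.
  have [b0 b1] : 0 <= a ^+ 2 /\ a ^+ 2 <= 1 / 4 by split; nra.
  rewrite ler_pdivrMr; nra.
lra.
Qed.

Section uniform.
Context {R : realType} (d : nat).
Variable sigma : probability (d.-tuple R) R.
Hypothesis sigmaU : sphere_uniform sigma.
Implicit Types x y z : d.-tuple R.

Local Notation S := (@sphere R d).
Local Notation E f := (Rintegral sigma S f).
Let mS : measurable S := @measurable_sphere R d.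
Let sS : sigma S = 1%E := sigmaU.1.

Lemma measurable_dotr x : measurable_fun setT (dot x).
Proof. by apply: measurable_dot => //; exact: measurable_cst. Qed.

Lemma measurable_dotl x : measurable_fun setT (fun y => dot y x).
Proof. by apply: measurable_dot => //; exact: measurable_cst. Qed.

Lemma bmfun_dot x : bmfun S (dot x).
Proof.
split; first exact: measurable_dotr.
exists ((dot x x + 1) / 2) => y Sy; rewrite ler_norml.
have := dot_ge0 (lincomb 1 x 1 y); have := dot_ge0 (lincomb 1 x (-1) y).
rewrite !(dot_lincombl, dot_lincombr) (_ : dot y y = 1)// (dotC y x); lra.
Qed.

Lemma Ex_mxapp M f : orthogonal_mx M -> bmfun S f ->
  E (fun y => f (mxapp M y)) = E f.
Proof.
move=> OM bf; have [mf _] := bf; rewrite /Rintegral; congr fine.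
have SM : mxapp M @^-1` S = S.
  by apply/seteqP; split => y; rewrite /sphere /= dot_mxapp.
have mM := measurable_mxapp M.
transitivity (\int[pushforward sigma (mxapp M)]_(y in S) (f y)%:E)%E.
  rewrite integral_pushforward//= ?SM//; first exact/measurable_EFinP.
  have : bmfun S (fun y => f (mxapp M y)).
    split; first exact: measurableT_comp.
    have [_ [B fB]] := bf; exists B => y Sy; apply: fB.
    by rewrite -SM in Sy.
  exact: bmfun_integrable.
by apply: eq_measure_integral => A mA _; exact: sigmaU.2.
Qed.

(** Three vectors suffice for the strip estimate: a cap centre z and the two directions e, f that
    are mixed. *)
Lemma Ex_gram x0 x1 x2 x0' x1' x2' (F : R -> R -> R -> R) :
  dot x0 x0 = dot x0' x0' -> dot x1 x1 = dot x1' x1' -> dot x2 x2 = dot x2' x2' ->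
  dot x0 x1 = dot x0' x1' -> dot x0 x2 = dot x0' x2' -> dot x1 x2 = dot x1' x2' ->
  bmfun S (fun y => F (dot x0 y) (dot x1 y) (dot x2 y)) ->
  E (fun y => F (dot x0 y) (dot x1 y) (dot x2 y)) =
  E (fun y => F (dot x0' y) (dot x1' y) (dot x2' y)).
Proof.
move=> e00 e11 e22 e01 e02 e12 bF.
pose xs i := nth x0 [:: x0; x1; x2] i; pose xs' i := nth x0' [:: x0'; x1'; x2'] i.
have [|M OM Mx] := @gram_orthogonal _ _ 3 xs' xs.
  by move=> [|[|[|i]]] [|[|[|j]]] //= _ _; rewrite /xs /xs' /= -?(e00, e11, e22, e01, e02, e12)//;
    rewrite dotC -(e01, e02, e12) dotC.
have Mtx i : (i < 3)%N -> forall y, dot (xs i) (mxapp M y) = dot (xs' i) y.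
  by move=> i3 y; rewrite -Mx// dot_mxapp.
rewrite -(Ex_mxapp OM bF); apply: eq_Ex => y _.
by rewrite (Mtx 0%N)// (Mtx 1%N)// (Mtx 2%N).
Qed.

Lemma Ex_gram2 x0 x1 x0' x1' (F : R -> R -> R) :
  dot x0 x0 = dot x0' x0' -> dot x1 x1 = dot x1' x1' -> dot x0 x1 = dot x0' x1' ->
  bmfun S (fun y => F (dot x0 y) (dot x1 y)) ->
  E (fun y => F (dot x0 y) (dot x1 y)) = E (fun y => F (dot x0' y) (dot x1' y)).
Proof.
by move=> *; rewrite (@Ex_gram x0 x1 x1 x0' x1' x1' (fun a b _ => F a b)).
Qed.

Lemma Ex_unit x x' (F : R -> R) : dot x x = 1 -> dot x' x' = 1 ->
  bmfun S (fun y => F (dot x y)) ->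
  E (fun y => F (dot x y)) = E (fun y => F (dot x' y)).
Proof.
by move=> x1 x1' bF; rewrite (@Ex_gram2 x x x' x' (fun a _ => F a)) ?x1 ?x1'.
Qed.

Definition unitv (i : 'I_d) : d.-tuple R := [tuple (j == i)%:R | j < d].

Lemma dot_unitv i y : dot (unitv i) y = tnth y i.
Proof.
rewrite /dot (bigD1 i)//= big1 ?addr0 => [|j ji]; rewrite tnth_mktuple ?eqxx ?mul1r//.
by rewrite (negbTE ji) mul0r.
Qed.

Lemma dot_unitvE i j : dot (unitv i) (unitv j) = (i == j)%:R.
Proof. by rewrite dot_unitv tnth_mktuple. Qed.

Hypothesis d0 : (0 < d)%N.

Definition signv (e : {ffun 'I_d -> bool}) : d.-tuple R :=
  [tuple (-1) ^+ e i / Num.sqrt d%:R | i < d].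

Lemma dot_signv e : dot (signv e) (signv e) = 1.
Proof.
rewrite /dot (eq_bigr (fun=> d%:R^-1)) => [|i _].
  by rewrite sumr_const card_ord -[LHS]mulr_natr mulVf// pnatr_eq0 -lt0n.
rewrite tnth_mktuple mulrACA -expr2 sqrr_sign mul1r -invfM -expr2 sqr_sqrtr//.
Qed.

(* The law of <x, y> does not depend on the unit vector x, so x may be averaged
   over the sign vectors. *)
Lemma Ex_expR x (l : R) : dot x x = 1 ->
  E (fun y => expR (l * dot x y)) <= expR (2 * l ^+ 2 / d%:R).
Proof.
move=> x1; pose F a := expR (l * a).
have bF z : bmfun S (fun y => F (dot z y)) by rewrite /F; bmf; exact: bmfun_dot.
have bE e : bmfun S (fun y => F (dot (signv e) y)) by [].
pose N : R := #|{: {ffun 'I_d -> bool}}|%:R.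
have N0 : 0 < N by rewrite ltr0n card_ffun card_bool expn_gt0.
rewrite -(ler_pM2l N0).
have -> : N * E (fun y => expR (l * dot x y)) =
    E (fun y => \sum_(e : {ffun 'I_d -> bool}) F (dot (signv e) y)).
  rewrite Ex_sum// (eq_bigr (fun=> E (fun y => F (dot x y)))) => [|e _].
    by rewrite sumr_const mulr_natl.
  by apply: Ex_unit => //; exact: dot_signv.
apply: Ex_le_cst => //; first exact: bmfun_sum.
move=> y Sy; pose a i : R := l * (tnth y i / Num.sqrt d%:R).
have -> : \sum_(e : {ffun 'I_d -> bool}) F (dot (signv e) y) =
    \prod_(i < d) (expR (a i) + expR (- a i)).
  transitivity (\prod_(i < d) \sum_(b : bool) expR ((-1) ^+ b * a i)); last first.
    by apply: eq_bigr => i _; rewrite big_bool /= expr1 expr0 mulN1r mul1r addrC.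
  rewrite bigA_distr_bigA; apply: eq_bigr => e _; rewrite /F /dot mulr_sumr expR_sum.
  by apply: eq_bigr => i _; rewrite tnth_mktuple /a; congr expR; ring.
apply: (@le_trans _ _ (\prod_(i < d) (2 * expR (2 * a i ^+ 2)))).
  by apply: ler_prod => i _; rewrite addr_ge0 ?expR_ge0// cosh_le.
rewrite big_split/= prodr_const card_ord -expR_sum /N card_ffun card_bool card_ord natrX.
rewrite ler_wpM2l ?exprn_ge0// ler_expR le_eqVlt; apply/predU1P; left.
rewrite (eq_bigr (fun i => 2 * l ^+ 2 / d%:R * (tnth y i * tnth y i))) => [|i _].
  by rewrite -mulr_sumr -/(dot y y) (_ : dot y y = 1) ?mulr1.
rewrite /a !exprMn exprVn sqr_sqrtr//; ring.
Qed.

End uniform.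

Lemma Rintegral_ind {R : realType} {dT} {T : measurableType dT}
    (P : probability T R) (b : T -> bool) : measurable_fun setT b ->
  \int[P]_x (b x)%R%:R = fine (P [set x | b x]).
Proof.
move=> mb; have mB : measurable [set x | b x].
  by have := mb measurableT [set true] I; rewrite setTI.
rewrite -(setIT [set x | b x]) -integral_indic// /Rintegral; congr fine.
apply: eq_integral => x _; rewrite indicE; congr (_%:R)%:E.
by case bx: (b x); [rewrite mem_set|rewrite memNset//= bx].
Qed.

(** * Tails and truncated moments of an inner product *)

Section tails.
Context {R : realType} (d : nat).
Variable sigma : probability (d.-tuple R) R.
Hypothesis sigmaU : sphere_uniform sigma.
Hypothesis d0 : (0 < d)%N.
Implicit Types x y z : d.-tuple R.

Local Notation S := (@sphere R d).
Local Notation E f := (Rintegral sigma S f).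
Let mS : measurable S := @measurable_sphere R d.
Let sS : sigma S = 1%E := sigmaU.1.
Let dR0 : 0 < d%:R :> R. Proof. by rewrite ltr0n. Qed.

Lemma tail_le x (a : R) : dot x x = 1 -> 0 <= a ->
  E (fun y => (a <= dot x y)%R%:R) <= expR (- (d%:R * a ^+ 2 / 8)).
Proof.
(* This l minimises the Chernoff exponent - l a + 2 l^2 / d. *)
move=> x1 a0; pose l := d%:R * a / 4; have bx := bmfun_dot x; have [mx _] := bx.
have l0 : 0 <= l by rewrite divr_ge0// mulr_ge0// ler0n.
apply: (@le_trans _ _ (E (fun y => expR (- (l * a)) * expR (l * dot x y)))).
  apply: Ex_le => // [||y _]; [by bmf|by bmf|].
  rewrite -expRD; case: (leP a (dot x y)) => [ay|_]; last by rewrite /= ?mulr0n expR_ge0.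
  by rewrite /= mulr1n -(@expR0 R) ler_expR -mulrN -mulrDr mulr_ge0// addrC subr_ge0.
rewrite ExZl//; last by bmf.
apply: (le_trans (ler_wpM2l (expR_ge0 _) (Ex_expR sigmaU d0 l x1))).
rewrite -expRD ler_expR le_eqVlt; apply/predU1P; left; rewrite /l; field.
by rewrite gt_eqF.
Qed.

Lemma abs_tail_le x (a : R) : dot x x = 1 -> 0 <= a ->
  E (fun y => (a <= `|dot x y|)%R%:R) <= 2 * expR (- (d%:R * a ^+ 2 / 8)).
Proof.
move=> x1 a0; have bx := bmfun_dot x; have [mx _] := bx.
have x1' : dot (lincomb (-1) x 0 x) (lincomb (-1) x 0 x) = 1.
  by rewrite !(dot_lincombl, dot_lincombr) x1; ring.
set x' := lincomb _ _ _ _ in x1'; have [mx' _] := bmfun_dot x'.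
have mn : measurable_fun setT (fun y => `|dot x y|) by case: (bmfun_norm bx).
apply: (@le_trans _ _ (E (fun y => (a <= dot x y)%R%:R + (a <= dot x' y)%R%:R))).
  apply: Ex_le => // [||y _]; [by bmf|by bmf|].
  rewrite ler_normr dot_lincombl mul0r addr0 mulN1r.
  by case: (leP a) => _; case: (leP a) => _ /=; rewrite ?addr0 ?add0r// lerDl ler0n.
rewrite ExD//; [|by bmf|by bmf].
have := tail_le x1 a0; have := tail_le x1' a0; lra.
Qed.

(** The square of w = l |<x, y>| is at most 8 L^2 plus an exponential of mean O(exp(- L)).
    Conditioning on an event of probability at least exp(- L) thus costs only a factor L over the
    typical size 1 / d. *)
Lemma second_moment_le x (g : d.-tuple R -> R) (L : R) : dot x x = 1 -> 1 <= L ->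
  bmfun S g -> (forall y, 0 <= g y <= 1) ->
  E (fun y => g y * dot x y ^+ 2) <= 32 * (L / d%:R) * (E g + expR (- L)).
Proof.
move=> x1 L1 bg g01; have bx := bmfun_dot x.
have L0 : 0 < L by lra.
(* Chosen so that 2 l^2 / d, the exponent in [Ex_expR], equals L. *)
pose l := Num.sqrt (d%:R * L / 2).
have l2 : l ^+ 2 = d%:R * L / 2 by rewrite sqr_sqrtr// divr_ge0// mulr_ge0// ltW.
have l0 : 0 < l by rewrite sqrtr_gt0 divr_gt0// mulr_gt0.
pose h y := expR (- (2 * L)) * (expR (l * dot x y) + expR (- l * dot x y)).
have H : E (fun y => g y * dot x y ^+ 2 * l ^+ 2) <=
         E (fun y => g y * (8 * L ^+ 2) + 8 * h y).
  apply: Ex_le => // [||y _]; [by bmf|by rewrite /h; bmf|].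
  have /andP[g0 g1] := g01 y; have h0 : 0 <= h y.
    by rewrite /h mulr_ge0 ?addr_ge0 ?expR_ge0.
  suff : (l * dot x y) ^+ 2 <= 8 * L ^+ 2 + 8 * h y.
    by rewrite exprMn => H; nra.
  rewrite -real_normK ?num_real//; set w := `|_|.
  have [wL|wL] := leP w (2 * L).
    by have := normr_ge0 (l * dot x y); rewrite -/w; nra.
  have H1 : (w - 2 * L) ^+ 2 <= 4 * expR (w - 2 * L) by apply: expR_ge_sqr; lra.
  have H2 : expR (w - 2 * L) <= h y.
    rewrite addrC expRD ler_pM2l ?expR_gt0// /w mulNr.
    by case: (leP 0 (l * dot x y)) => [/ger0_norm|/ltr0_norm] ->;
      rewrite ?lerDl ?lerDr expR_ge0.
  (* This is w^2 <= 2 (w - 2 L)^2 + 8 L^2. *)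
  have H3 := sqr_ge0 (w - 4 * L); nra.
have H3 : E h <= 2 * expR (- L).
  rewrite ExZl//; last by bmf.
  rewrite ExD//; [|by bmf|by bmf].
  have -> : expR (- L) = expR (- (2 * L)) * expR L.
    by rewrite -expRD; congr expR; ring.
  have e1 := Ex_expR sigmaU d0 l x1; have e2 := Ex_expR sigmaU d0 (- l) x1.
  have eL : 2 * l ^+ 2 / d%:R = L by rewrite l2; field; rewrite gt_eqF.
  rewrite sqrrN eL in e2; rewrite eL in e1.
  rewrite mulrCA ler_pM2l ?expR_gt0//; lra.
rewrite ExZr// in H; last by bmf.
rewrite ExD// in H; [|by bmf|by rewrite /h; bmf].
rewrite ExZr// ExZl// in H; last by rewrite /h; bmf.
have e0 := expR_ge0 (- L).
have Eg0 : 0 <= E g by apply: Ex_ge0 => y _; case/andP: (g01 y).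
set X := E (fun y => g y * dot x y ^+ 2) in H *.
have : X * l ^+ 2 <= 16 * L ^+ 2 * (E g + expR (- L)).
  have L2 : 0 <= L ^+ 2 - 1 by nra.
  by have := mulr_ge0 L2 e0; have := mulr_ge0 (sqr_ge0 L) Eg0; lra.
rewrite l2 -ler_pdivlMr; last by rewrite divr_gt0// mulr_gt0.
move/le_trans; apply; rewrite le_eqVlt; apply/predU1P; left; field.
by rewrite !gt_eqF.
Qed.

End tails.

(** * The threshold and the measure of a cap *)

Section threshold.
Context {R : realType} (d : nat).
Variable sigma : probability (d.-tuple R) R.
Hypothesis sigmaU : sphere_uniform sigma.
Hypothesis d0 : (0 < d)%N.
Variables (p t : R).
Hypothesis p01 : 0 < p <= 1 / 2.
Hypothesis pt : is_threshold sigma p t.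
Implicit Types x y z : d.-tuple R.

Local Notation S := (@sphere R d).
Local Notation E f := (Rintegral sigma S f).
Let mS : measurable S := @measurable_sphere R d.
Let sS : sigma S = 1%E := sigmaU.1.
Let dR0 : 0 < d%:R :> R. Proof. by rewrite ltr0n. Qed.

Local Notation L := (ln (1 / p)).
Local Notation th := (Num.sqrt (L / d%:R)).

Lemma ln_inv_ge : 1 / 2 <= L.
Proof.
have /andP[p0 p2] := p01; rewrite -ler_expR lnK ?posrE ?divr_gt0//.
apply: (@le_trans _ _ 2); last by rewrite ler_pdivlMr//; lra.
have h := @cosh_le R (1 / 2).
rewrite -[expR _]invrK -expRN -[leRHS]invrK lef_pV2 ?posrE ?expR_gt0//.
by apply: le_trans (expR_ge1Dx _); lra.
Qed.
Let L0 : 0 < L. Proof. by have := ln_inv_ge; lra. Qed.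

Lemma expR_ln_inv n : expR (- (n%:R * L)) = p ^+ n.
Proof.
have /andP[p0 _] := p01.
by rewrite mulrC -mulNr -lnV ?posrE ?divr_gt0// div1r invrK expRM_natr lnK.
Qed.

Lemma theta_gt0 : 0 < th. Proof. by rewrite sqrtr_gt0 divr_gt0. Qed.

Lemma theta_sqr : th ^+ 2 = L / d%:R.
Proof. by rewrite sqr_sqrtr// divr_ge0// ltW. Qed.

(** The exponent 2 L makes the error exp(- 2 L) = p^2, the typical measure of an intersection of two
    caps. *)
Lemma moment2_le x (g : d.-tuple R -> R) : dot x x = 1 ->
  bmfun S g -> (forall y, 0 <= g y <= 1) ->
  E (fun y => g y * dot x y ^+ 2) <= 64 * th ^+ 2 * (E g + p ^+ 2).
Proof.
move=> x1 bg g01; have := @second_moment_le _ _ _ sigmaU d0 x g (2 * L) x1 _ bg g01.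
have := ln_inv_ge; rewrite (expR_ln_inv 2) theta_sqr => l2 /(_ _)/le_trans -> //; first by lra.
by rewrite le_eqVlt; apply/predU1P; left; field; rewrite gt_eqF.
Qed.

(** AM-GM at the scale th: w <= w^2 / (2 th) + th / 2. *)
Lemma moment1_le x (g : d.-tuple R -> R) : dot x x = 1 ->
  bmfun S g -> (forall y, 0 <= g y <= 1) ->
  E (fun y => g y * `|dot x y|) <= 33 * th * (E g + p ^+ 2).
Proof.
move=> x1 bg g01; have m2 := moment2_le x1 bg g01; have bx := bmfun_dot x.
have t0 := theta_gt0.
have Eg0 : 0 <= E g by apply: Ex_ge0 => y _; case/andP: (g01 y).
apply: (@le_trans _ _ (E (fun y =>
  (2 * th)^-1 * (g y * dot x y ^+ 2) + (th / 2) * g y))).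
  apply: Ex_le => // [||y _]; [by bmf|by bmf|].
  have /andP[g0 _] := g01 y; rewrite -[dot x y ^+ 2]real_normK ?num_real//.
  set w := `|_|; rewrite -subr_ge0.
  have -> : (2 * th)^-1 * (g y * w ^+ 2) + th / 2 * g y - g y * w =
     g y * (w - th) ^+ 2 / (2 * th) by field; rewrite gt_eqF.
  apply: divr_ge0; apply: mulr_ge0 => //; exact: sqr_ge0.
rewrite ExD//; [|by bmf|by bmf].
rewrite (ExZl mS sS (2 * th)^-1 (f := fun y => g y * dot x y ^+ 2)); last by bmf.
rewrite (ExZl mS sS (th / 2) bg).
apply: (@le_trans _ _ ((2 * th)^-1 * (64 * th ^+ 2 * (E g + p ^+ 2)) + th / 2 * E g)).
  by rewrite lerD2r ler_pM2l// invr_gt0 mulr_gt0.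
have -> : (2 * th)^-1 * (64 * th ^+ 2 * (E g + p ^+ 2)) = 32 * th * (E g + p ^+ 2).
  by field; rewrite gt_eqF.
have := sqr_ge0 p; nra.
Qed.

Lemma measurable_cap z : measurable_fun setT (fun y => t <= dot y z).
Proof.
by apply: measurable_fun_ler; [exact: measurable_cst|exact: measurable_dotl].
Qed.

Lemma bmfun_cap z (D : set (d.-tuple R)) : bmfun D (fun y => (t <= dot y z)%R%:R : R).
Proof. by apply: bmfun_ind; exact: measurable_cap. Qed.

(** [is_threshold] averages over pairs; by invariance the inner integral is the same for all
    centres, so each cap has measure exactly p. *)
Lemma Ex_cap z : dot z z = 1 -> E (fun y => (t <= dot y z)%R%:R) = p.
Proof.
move=> z1; pose b (u : d.-tuple R * d.-tuple R) := t <= dot u.1 u.2.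
have mb : measurable_fun setT b.
  by apply: measurable_fun_ler; [exact: measurable_cst|apply: measurable_dot].
have bF : bmfun setT (fun u => (b u)%R%:R : R) by exact: bmfun_ind.
have : \int[(sigma \x sigma)%E]_u ((b u)%R%:R) = p.
  by rewrite (Rintegral_ind (sigma \x sigma)%E mb) [X in fine X](_ : _ = p%:E).
rewrite Rintegral_prod//.
have bG : bmfun setT (fun x => \int[sigma]_y ((b (x, y))%R%:R : R)).
  exact: (bmfun_Rintegral sigma bF).
rewrite (Ex_setT mS sS)// => <-; rewrite -[LHS](Ex_cst mS sS).
apply: eq_Ex => x Sx; rewrite (Ex_setT mS sS); last exact: (bmfun_pair1 (F := fun u => (b u)%R%:R)).
rewrite (@eq_Ex _ _ _ _ _ (fun y => (t <= dot y z)%R%:R) (fun y => (t <= dot z y)%R%:R)); last first.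
  by move=> y _; rewrite dotC.
apply: (Ex_unit sigmaU (F := fun a => (t <= a)%R%:R)) => //.
by apply: bmfun_ind; mbool; exact: measurable_dotr.
Qed.

(** For t >= 0 the tail bound at t must be at least p = exp(- L). For t < 0 the complement of the
    cap, of measure 1 - p >= p, lies in the opposite cap of height - t. *)
Lemma threshold_sqr_le : t ^+ 2 <= 8 * th ^+ 2.
Proof.
have /andP[p0 p2] := p01.
have i0 : (0 < d)%N by []; pose z : d.-tuple R := unitv (Ordinal i0).
have z1 : dot z z = 1 by rewrite dot_unitvE eqxx.
have [mz _] := bmfun_dot z.
suff : p <= expR (- (d%:R * t ^+ 2 / 8)).
  have e : expR (- L) = p by rewrite -[RHS]expr1 -[RHS]expR_ln_inv; congr expR; ring.
  rewrite -[X in X <= _]e ler_expR lerN2 theta_sqr => H.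
  by rewrite mulrA ler_pdivlMr// mulrC; lra.
have Et : E (fun y => (t <= dot z y)%R%:R) = p.
  by rewrite -(Ex_cap z1); apply: eq_Ex => y _; rewrite dotC.
have [t0|t0] := leP 0 t; first by rewrite -Et tail_le.
have z1' : dot (lincomb (-1) z 0 z) (lincomb (-1) z 0 z) = 1.
  by rewrite !(dot_lincombl, dot_lincombr) z1; ring.
set z' := lincomb _ _ _ _ in z1'; have [mz' _] := bmfun_dot z'.
have := @tail_le _ _ _ sigmaU d0 z' (- t) z1'; rewrite sqrrN oppr_ge0 => /(_ (ltW t0)).
apply: le_trans.
have : E (fun y => 1 - (t <= dot z y)%R%:R) <= E (fun y => (- t <= dot z' y)%R%:R).
  apply: Ex_le => // [||y _]; [by bmf|by bmf|].
  rewrite dot_lincombl mul0r addr0 mulN1r lerN2.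
  by case: (leP t) => [_|/ltW ->]; [rewrite subrr ler0n|rewrite subr0].
rewrite ExB//; [|by bmf|by bmf].
rewrite Ex_cst// Et; lra.
Qed.

End threshold.

(** * Density of a strip *)

Section clip.
Context {R : realFieldType}.
Implicit Types lo hi x y : R.

(** For lo <= hi, the primitive of the indicator of [lo, hi] that vanishes at lo. *)
Definition clip lo hi x := Num.max 0 (Num.min x hi - lo).


Lemma clip_ge0 lo hi x : 0 <= clip lo hi x.
Proof. by rewrite /clip le_max lexx. Qed.

Lemma clip_mono lo hi x y : x <= y -> clip lo hi x <= clip lo hi y.
Proof.
by move=> xy; rewrite /clip !maxEle !minEle; repeat case: ifPn; rewrite -?ltNge; lra.
Qed.

Lemma clip_lip lo hi x y : `|clip lo hi x - clip lo hi y| <= `|x - y|.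
Proof.
rewrite ler_norml /clip; have := ler_norm (x - y); have := ler_norm (y - x).
rewrite distrC; set w := `|_|.
by rewrite !maxEle !minEle; repeat case: ifPn; rewrite -?ltNge; lra.
Qed.

Lemma clip_le lo hi x : lo <= hi -> clip lo hi x <= (hi - lo) * (lo <= x)%R%:R.
Proof.
move=> lh; rewrite /clip !maxEle !minEle; case: (leP lo x) => /= lx;
rewrite ?mulr1 ?mulr0; repeat case: ifPn; rewrite -?ltNge; lra.
Qed.

(** A discrete derivative. For u in [lo, hi] and v >= 0, both c u and c u + s v stay below hi + 2 s,
    so the upper cut is not felt, and c u undershoots lo by at most s^2. In all other cases the left
    side is 0 and monotonicity suffices. *)
Lemma clip_shift lo hi c s u v : 0 < s -> s <= 1 -> 0 <= c -> c <= 1 ->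
    1 - c <= s ^+ 2 -> `|u| <= 1 -> `|v| <= 1 ->
  (0 <= v)%R%:R * (lo <= u <= hi)%R%:R * (s * v ^+ 2 - s ^+ 2) <=
  v * (clip lo (hi + 2 * s) (c * u + s * v) - clip lo (hi + 2 * s) (c * u)).
Proof.
move=> s0 s1 c0 c1 cs; rewrite !ler_norml => /andP[u1 u2] /andP[v1 v2].
have s2 : s ^+ 2 <= s by nra.
case: (leP 0 v) => [v0|v0] /=; last first.
  have : clip lo (hi + 2 * s) (c * u + s * v) <= clip lo (hi + 2 * s) (c * u).
    by apply: clip_mono; nra.
  by rewrite !mul0r; nra.
have h1 : clip lo (hi + 2 * s) (c * u) <= clip lo (hi + 2 * s) (c * u + s * v).
  by apply: clip_mono; nra.
have [/andP[lu uh]|_] := boolP (lo <= u <= hi); last by rewrite mulr0 mul0r; nra.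
rewrite !mul1r.
have cu : u - s ^+ 2 <= c * u <= u + s ^+ 2 by nra.
have sv : s * v <= s by nra.
suff : s * v - s ^+ 2 <=
    clip lo (hi + 2 * s) (c * u + s * v) - clip lo (hi + 2 * s) (c * u) by nra.
move: cu => /andP[cu1 cu2]; have sv0 : 0 <= s * v by nra.
clear h1 u1 u2 v1 v2 c0 c1 cs.
set a := c * u in cu1 cu2 *; set b := s * v in sv sv0 *; set q := s ^+ 2 in s2 cu1 cu2 *.
have q0 : 0 <= q by exact: sqr_ge0.
by rewrite /clip !maxEle !minEle; repeat case: ifPn; rewrite -?ltNge; lra.
Qed.

End clip.

Section strip.
Context {R : realType} (d : nat).
Variable sigma : probability (d.-tuple R) R.
Hypothesis sigmaU : sphere_uniform sigma.
Implicit Types x y z e f : d.-tuple R.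

Local Notation S := (@sphere R d).
Local Notation E f := (Rintegral sigma S f).
Let mS : measurable S := @measurable_sphere R d.
Let sS : sigma S = 1%E := sigmaU.1.

Variables (z e f : d.-tuple R) (A : R -> bool) (lo hi : R -> R).
Hypotheses (ee : dot e e = 1) (ff : dot f f = 1).
Hypotheses (ze : dot z e = 0) (zf : dot z f = 0) (ef : dot e f = 0).
Hypothesis mA : measurable_fun setT (fun y => A (dot z y)).
Hypothesis blo : bmfun S (fun y => lo (dot z y)).
Hypothesis bhi : bmfun S (fun y => hi (dot z y)).
Hypothesis lohi : forall s, A s -> lo s <= hi s.

Let bz := bmfun_dot z.
Let be := bmfun_dot e.
Let bf := bmfun_dot f.

Let ipA y : R := (A (dot z y))%:R.
Let bA : bmfun S ipA. Proof. exact: bmfun_ind. Qed.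
Let A01 y : 0 <= ipA y <= 1. Proof. by rewrite /ipA; case: (A _); rewrite lexx ler01. Qed.

Let inS u : dot u u = 1 -> forall y, S y -> `|dot u y| <= 1.
Proof. by move=> u1 y Sy; exact: cauchy_schwarz_unit. Qed.

Let H k s u : R := (A s)%:R * clip (lo s) (hi s + k) u.

Let bH k (g : d.-tuple R -> R) : bmfun S g -> bmfun S (fun y => H k (dot z y) (g y)).
Proof. by move=> bg; rewrite /H /clip; apply: bmfunM => //; bmf. Qed.

Let flip (F : R -> R -> R -> R) : bmfun S (fun y => F (dot z y) (dot e y) (dot f y)) ->
  E (fun y => F (dot z y) (dot e y) (dot f y)) =
  E (fun y => F (dot z y) (dot e y) (- dot f y)).
Proof.
move=> bF; rewrite (@Ex_gram _ _ _ sigmaU z e f z e (lincomb (-1) f 0 f) F)//.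
- by apply: eq_Ex => y _; rewrite dot_lincombl mul0r addr0 mulN1r.
- by rewrite !(dot_lincombl, dot_lincombr) ff; ring.
- by rewrite !(dot_lincombl, dot_lincombr) zf; ring.
- by rewrite !(dot_lincombl, dot_lincombr) ef; ring.
Qed.

Let odd0 k c : E (fun y => dot f y * H k (dot z y) (c * dot e y)) = 0.
Proof.
have bHc : bmfun S (fun y => H k (dot z y) (c * dot e y)) by apply: bH; bmf.
have := @flip (fun a b g => g * H k a (c * b)); rewrite /= => /(_ _)/wrap[]; first by bmf.
move=> eq; have {}eq : E (fun y => dot f y * H k (dot z y) (c * dot e y)) =
   - E (fun y => dot f y * H k (dot z y) (c * dot e y)).
  rewrite {1}eq -mulN1r -ExZl//; last by bmf.
  by apply: eq_Ex => y _; ring.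
lra.
Qed.

(** Replacing (e, f) by (c e + s f, s e - c f), which has the same Gram matrix, in
    E[<f, y> H(<e, y>)] = 0 gives E[(s <e, y> - c <f, y>) H(c <e, y> + s <f, y>)] = 0; the
    subtracted term is 0 by oddness. Divided by s, this is integration by parts as s -> 0. *)
Let rotate k c s : c ^+ 2 + s ^+ 2 = 1 ->
  c * E (fun y => dot f y * (H k (dot z y) (c * dot e y + s * dot f y) -
                             H k (dot z y) (c * dot e y))) =
  s * E (fun y => dot e y * H k (dot z y) (c * dot e y + s * dot f y)).
Proof.
move=> cs; have b1 : bmfun S (fun y => H k (dot z y) (c * dot e y + s * dot f y)).
  by apply: bH; bmf.
have b2 : bmfun S (fun y => H k (dot z y) (c * dot e y)) by apply: bH; bmf.
have b3 : bmfun S (fun y => H k (dot z y) (dot e y)) by exact: bH.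
have o1 : E (fun y => dot f y * H k (dot z y) (dot e y)) = 0.
  by rewrite -[RHS](odd0 k 1); apply: eq_Ex => y _; rewrite mul1r.
have fe : dot f e = 0 by rewrite dotC.
have eq := @Ex_gram _ _ _ sigmaU z e f z (lincomb c e s f) (lincomb s e (- c) f)
  (fun a b g => g * H k a b).
rewrite /= o1 in eq; have {}eq := eq erefl _ _ _ _ _ _.
have {}eq : 0 = E (fun y => dot (lincomb s e (- c) f) y *
    H k (dot z y) (dot (lincomb c e s f) y)).
  apply: eq; rewrite ?(dot_lincombl, dot_lincombr) ?ee ?ff ?ze ?zf ?ef ?fe; by [ring|bmf|
    rewrite -[LHS]cs; ring].
under eq_Rintegral do rewrite mulrBr.
rewrite ExB//; [|by bmf|by bmf].
rewrite odd0 subr0 -!ExZl//; [|by bmf|by bmf].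
apply/eqP; rewrite -subr_eq0 -ExB//; [|by bmf|by bmf].
rewrite -oppr_eq0 -mulN1r -ExZl//; last by bmf.
rewrite [X in _ == X]eq; apply/eqP/eq_Ex => y _; rewrite !dot_lincombl; ring.
Qed.

(** [H] is a primitive, in <e, y>, of the strip indicator, so [rotate] compares E[1_strip <f, y>^2]
    with E[<e, y> H]. The ends [lo] and [hi] may vary with <z, y>, which is not affected. The
    difference quotient is exploited on <f, y> >= 0 only, whence the factor 2. *)
Lemma strip_le :
  E (fun y => ipA y * (lo (dot z y) <= dot e y <= hi (dot z y))%R%:R * dot f y ^+ 2) <=
  2 * E (fun y => ipA y * (`|dot e y| * (hi (dot z y) - lo (dot z y)) *
                           (lo (dot z y) <= dot e y)%R%:R)).
Proof.
pose st y : R := (lo (dot z y) <= dot e y <= hi (dot z y))%R%:R.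
have [mlo _] := blo; have [mhi _] := bhi; have [me _] := be; have [mf _] := bf.
have bst : bmfun S st.
  by rewrite /st; apply: bmfun_ind; apply: measurable_and; apply: measurable_fun_ler.
have mf0 : measurable_fun setT (fun y => 0 <= dot f y)%R.
  by apply: measurable_fun_ler => //; exact: measurable_cst.
have mu0 : measurable_fun setT (fun y => lo (dot z y) <= dot e y)%R.
  exact: measurable_fun_ler.
have bv : bmfun S (fun y => (0 <= dot f y)%R%:R : R) by exact: bmfun_ind.
have bu : bmfun S (fun y => (lo (dot z y) <= dot e y)%R%:R : R) by exact: bmfun_ind.
pose RR := E (fun y => ipA y * (`|dot e y| * (hi (dot z y) - lo (dot z y)) *
  (lo (dot z y) <= dot e y)%R%:R)); rewrite -/RR.
pose Q := E (fun y => (0 <= dot f y)%R%:R * (ipA y * st y) * dot f y ^+ 2).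
have Q2 : E (fun y => ipA y * st y * dot f y ^+ 2) <= 2 * Q.
  have -> : 2 * Q = Q + E (fun y => (0 <= - dot f y)%R%:R * (ipA y * st y) * dot f y ^+ 2).
    rewrite mulr_natl mulr2n; congr (_ + _); rewrite /Q /ipA /st.
    rewrite (@flip (fun a b g => (0 <= g)%R%:R *
      ((A a)%:R * (lo a <= b <= hi a)%R%:R) * g ^+ 2)); last by bmf.
    by apply: eq_Ex => y _; rewrite sqrrN.
  have mN : measurable_fun setT (fun y => - dot f y) by exact: measurableT_comp.
  rewrite -ExD//; [|by bmf|by bmf].
  apply: Ex_le => // [||y _]; [by bmf|by bmf|].
  rewrite -!mulrDl ler_wpM2r ?sqr_ge0// ler_peMl//.
    by rewrite mulr_ge0// ?ler0n//; case/andP: (A01 y).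
  rewrite oppr_ge0; case: (leP 0 (dot f y)) => [_|/ltW ->] /=;
    by rewrite ?lerDl ?lerDr ?ler0n.
apply: (@le_trans _ _ (2 * Q)); first exact: Q2.
rewrite ler_pM2l//.
have Q1 : Q <= 1.
  apply: Ex_le_cst => // [|y Sy]; first by bmf.
  have := inS ff Sy; rewrite -real_normK ?num_real// => h; have := normr_ge0 (dot f y).
  have /andP[] := A01 y; rewrite /st.
  case: (0 <= dot f y); case: (_ && _) => /=; rewrite ?mul1r ?mulr1 ?mulr0 ?mul0r; nra.
(* A finite difference with error O(s), for arbitrary s, replaces differentiation under the
   integral. *)
suff K s : 0 < s < 1 -> Q <= RR + 6 * s.
  apply/ler_addgt0Pr => eps eps0.
  pose s := Num.min (1 / 2) (eps / 6).
  apply: (le_trans (K s _)).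
    by rewrite lt_min gt_min; apply/andP; split; [apply/andP; split|apply/orP; left]; lra.
  by rewrite lerD2l mulrC -ler_pdivlMr// ge_min lexx orbT.
move=> /andP[s0 s1].
pose c := Num.sqrt (1 - s ^+ 2).
have c2 : c ^+ 2 = 1 - s ^+ 2 by rewrite sqr_sqrtr//; nra.
have c0 : 0 <= c by exact: sqrtr_ge0.
have c1 : c <= 1 by nra.
have cs : 1 - c <= s ^+ 2 by nra.
have := @rotate (2 * s) c s; rewrite c2 subrK => /(_ erefl).
set X := E _; set Y := E _ => XY.
have bH1 : bmfun S (fun y => H (2 * s) (dot z y) (c * dot e y + s * dot f y)).
  by apply: bH; bmf.
have bH2 : bmfun S (fun y => H (2 * s) (dot z y) (c * dot e y)) by apply: bH; bmf.
have h1 : s * (Q - s) <= X.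
  apply: (@le_trans _ _ (E (fun y => s * ((0 <= dot f y)%R%:R * (ipA y * st y) * dot f y ^+ 2) - s ^+ 2))).
    rewrite ExB//; [|by bmf|by bmf].
    by rewrite ExZl ?Ex_cst//; [rewrite -/Q; nra|bmf].
  apply: Ex_le => // [||y Sy]; [by bmf|by bmf|].
  have := @clip_shift _ (lo (dot z y)) (hi (dot z y)) c s (dot e y) (dot f y)
    s0 (ltW s1) c0 c1 cs (inS ee Sy) (inS ff Sy).
  rewrite /H -/(st y) -/(ipA y); set D1 := clip _ _ _; set D2 := clip _ _ _.
  have /andP[] := A01 y; rewrite /st.
  have := sqr_ge0 s; have := sqr_ge0 (dot f y).
  rewrite /ipA; case: (A _); case: (0 <= dot f y); case: (_ && _) => /=;
    rewrite ?(mul1r, mulr1, mulr0, mul0r); nra.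
have h2 : Y <= RR + 4 * s.
  apply: (@le_trans _ _ (E (fun y => ipA y * (`|dot e y| * (hi (dot z y) - lo (dot z y)) *
                           (lo (dot z y) <= dot e y)%R%:R) + 4 * s))); last first.
    by rewrite ExD ?Ex_cst//; [bmf|bmf].
  apply: Ex_le => // [||y Sy]; [by bmf|by bmf|].
  rewrite /H -/(ipA y) /ipA; have := @lohi (dot z y); case: (A _); last first.
    by rewrite !mul0r mulr0 add0r; nra.
  move=> /(_ isT) lh; rewrite !mul1r.
  have uS := inS ee Sy; have vS := inS ff Sy.
  set u := dot e y in uS *; set v := dot f y in vS *; set a := lo _ in lh *; set b := hi _ in lh *.
  have l1 := clip_lip a (b + 2 * s) (c * u + s * v) u.
  have l2 : `|c * u + s * v - u| <= 2 * s.
    rewrite ler_norml; move: uS vS; rewrite !ler_norml => /andP[? ?] /andP[? ?].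
    by apply/andP; split; nra.
  have l3 := @clip_le _ a (b + 2 * s) u _; have {}l3 := l3 ltac:(lra).
  set D1 := clip _ _ (c * u + s * v) in l1 *.
  have D10 : 0 <= D1 by exact: clip_ge0.
  apply: (@le_trans _ _ (`|u| * D1)); first by rewrite ler_wpM2r// ler_norm.
  have l4 : D1 <= clip a (b + 2 * s) u + 2 * s.
    by have := le_trans (ler_norm _) l1; lra.
  have u0 := normr_ge0 u.
  move: l3; case: (leP a u) => /= _; rewrite ?mulr1 ?mulr0; nra.
have h3 : c * (Q - s) <= RR + 4 * s.
  rewrite -(ler_pM2l s0); apply: (@le_trans _ _ (s * Y)); last by rewrite ler_pM2l.
  by rewrite -XY mulrCA ler_wpM2l.
have h4 : (1 - c) * (Q - s) <= s; last by lra.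
have [Qs|Qs] := leP (Q - s) 0; first by nra.
have : (1 - c) * (Q - s) <= s ^+ 2 * 1 by apply: ler_pM => //; lra.
by nra.
Qed.

End strip.

(** * Fubini on a set of full measure *)

Section restricted_Fubini.
Context {R : realType} {dT : measure_display} {T : measurableType dT}.
Variables (P : probability T R) (D : set T).
Hypotheses (mD : measurable D) (PD : P D = 1%E).
Local Notation E f := (Rintegral P D f).

Lemma bmfun_Ex {dX : measure_display} {X : measurableType dX} (F : X * T -> R) :
  bmfun setT F -> bmfun setT (fun x => E (fun y => F (x, y))).
Proof.
move=> bF; rewrite (_ : (fun x => _) = fun x => \int[P]_y F (x, y)).
  exact: bmfun_Rintegral.
by apply/funext => x; rewrite (Ex_setT mD PD)//; exact: bmfun_pair1.
Qed.

Lemma Ex_Fubini (F : T * T -> R) : bmfun setT F ->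
  E (fun x => E (fun y => F (x, y))) = E (fun y => E (fun x => F (x, y))).
Proof.
move=> bF; have bF' := bmfun_swap bF.
rewrite -(Ex_setT mD PD (bmfun_Ex bF)) -(Ex_setT mD PD (bmfun_Ex bF')).
transitivity (\int[P]_x \int[P]_y F (x, y)).
  by apply: eq_Rintegral => x _; rewrite (Ex_setT mD PD)//; exact: bmfun_pair1.
rewrite Rintegral_Fubini//; apply: eq_Rintegral => y _.
by rewrite (Ex_setT mD PD)//; exact: bmfun_pair2.
Qed.

End restricted_Fubini.

(** * Unit vectors in a plane through z *)

Section plane.
Context {R : realType} (d : nat).
Implicit Types x y z e : d.-tuple R.

Lemma sqrt_1sub (a : R) : `|a| <= 1 / 2 ->
  Num.sqrt (1 - a ^+ 2) ^+ 2 = 1 - a ^+ 2 /\ 6 / 7 <= Num.sqrt (1 - a ^+ 2) <= 1.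
Proof.
rewrite ler_norml => /andP[a1 a2]; have h : 0 <= 1 - a ^+ 2 by nra.
have e : Num.sqrt (1 - a ^+ 2) ^+ 2 = 1 - a ^+ 2 by rewrite sqr_sqrtr.
by split => //; have := sqrtr_ge0 (1 - a ^+ 2); nra.
Qed.

Lemma sqrt_1sub_lip (a b : R) : `|a| <= 1 / 2 -> `|b| <= 1 / 2 ->
  `|Num.sqrt (1 - a ^+ 2) - Num.sqrt (1 - b ^+ 2)| <= `|a - b|.
Proof.
move=> ha hb; have [ea /andP[a1 a2]] := sqrt_1sub ha; have [eb /andP[b1 b2]] := sqrt_1sub hb.
set u := Num.sqrt _ in ea a1 a2 *; set v := Num.sqrt _ in eb b1 b2 *.
have uv : `|u - v| * (u + v) = `|a - b| * `|a + b|.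
  rewrite -[u + v]ger0_norm; last by lra.
  by rewrite -!normrM -normrN; congr `|_|; rewrite -!subr_sqr ea eb; ring.
have ab : `|a + b| <= 1 by rewrite (le_trans (ler_normD _ _))//; lra.
have := normr_ge0 (a - b); have := normr_ge0 (u - v); nra.
Qed.

Lemma lincomb_unit z e (b : R) : dot z z = 1 -> dot e e = 1 -> dot z e = 0 ->
  `|b| <= 1 / 2 -> let x := lincomb b z (Num.sqrt (1 - b ^+ 2)) e in
  dot x x = 1 /\ dot x z = b.
Proof.
move=> z1 e1 ze hb; have [eb _] := sqrt_1sub hb.
rewrite /= !(dot_lincombl, dot_lincombr) z1 e1 (dotC e z) ze; split; last by ring.
by rewrite !mulr0 !mulr1 addr0 add0r -!expr2 eb; ring.
Qed.

Lemma in_plane x z : dot x x = 1 -> dot z z = 1 -> `|dot x z| <= 1 / 2 ->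
  exists e, [/\ dot e e = 1, dot z e = 0 &
    x = lincomb (dot x z) z (Num.sqrt (1 - dot x z ^+ 2)) e].
Proof.
move=> x1 z1 h; have [ec /andP[c1 c2]] := sqrt_1sub h.
set c := Num.sqrt _ in ec c1 c2 *; have c0 : c != 0 by rewrite gt_eqF//; lra.
exists (lincomb c^-1 x (- (dot x z / c)) z); split.
- rewrite !(dot_lincombl, dot_lincombr) x1 z1 (dotC z x).
  apply/eqP; rewrite -subr_eq0; apply/eqP; transitivity ((1 - dot x z ^+ 2 - c ^+ 2) / c ^+ 2).
    by field.
  by rewrite ec subrr mul0r.
- by rewrite !(dot_lincombl, dot_lincombr) z1 (dotC z x); ring.
- by apply: eq_from_tnth => i; rewrite !tnth_mktuple; field.
Qed.

(** As kernels depend on inner products only, x' may be chosen freely among the unit vectors with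
    <x', z> = b. In the plane of x and z, its distance to x is O(|<x, z> - b|), along the two fixed
    directions z and e. *)
Lemma move_in_plane x z (b : R) : dot x x = 1 -> dot z z = 1 ->
  `|dot x z| <= 1 / 2 -> `|b| <= 1 / 2 ->
  exists e x', [/\ dot e e = 1, dot x' x' = 1, dot x' z = b &
    forall y, `|dot x y - dot x' y| <= `|dot x z - b| * (`|dot z y| + `|dot e y|)].
Proof.
move=> x1 z1 h hb; have [e [e1 ze xE]] := in_plane x1 z1 h.
have [x'1 x'z] := lincomb_unit z1 e1 ze hb.
exists e, (lincomb b z (Num.sqrt (1 - b ^+ 2)) e); split => // y.
rewrite {1}xE !dot_lincombl; have := sqrt_1sub_lip h hb.
set c := Num.sqrt _; set c' := Num.sqrt _ => cc.
have -> : dot x z * dot z y + c * dot e y - (b * dot z y + c' * dot e y) =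
  (dot x z - b) * dot z y + (c - c') * dot e y by ring.
rewrite (le_trans (ler_normD _ _))// !normrM mulrDr lerD2l.
by rewrite ler_wpM2r.
Qed.

End plane.

(** * Mass of a strip *)

Section strip_mass.
Context {R : realType} (d : nat).
Variable sigma : probability (d.-tuple R) R.
Hypothesis sigmaU : sphere_uniform sigma.
Hypothesis d2 : (2 <= d)%N.
Implicit Types x y z e f : d.-tuple R.

Local Notation S := (@sphere R d).
Local Notation E f := (Rintegral sigma S f).
Let mS : measurable S := @measurable_sphere R d.
Let sS : sigma S = 1%E := sigmaU.1.

Variables (A : R -> bool) (lo hi : R -> R).
Hypothesis mA : forall z, measurable_fun setT (fun y => A (dot z y)).
Hypothesis blo : forall z, bmfun S (fun y => lo (dot z y)).
Hypothesis bhi : forall z, bmfun S (fun y => hi (dot z y)).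
Hypothesis lohi : forall s, A s -> lo s <= hi s.

Let F s u : R := (A s)%:R * (lo s <= u <= hi s)%R%:R.
Let G s u : R := (A s)%:R * (`|u| * (hi s - lo s) * (lo s <= u)%R%:R).

Let bF z e : bmfun S (fun y => F (dot z y) (dot e y)).
Proof.
have [mlo _] := blo z; have [mhi _] := bhi z; have [me _] := bmfun_dot e.
have := mA z => mAz; rewrite /F; apply: bmfunM; first exact: bmfun_ind.
by apply: bmfun_ind; apply: measurable_and; apply: measurable_fun_ler.
Qed.

Let bG z e : bmfun S (fun y => G (dot z y) (dot e y)).
Proof.
have bl := blo z; have bh := bhi z; have be := bmfun_dot e.
have [ml _] := bl; have [me _] := be.
have := mA z => mAz; rewrite /G; apply: bmfunM; first exact: bmfun_ind.
apply: bmfunM; first by bmf.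
by apply: bmfun_ind; apply: measurable_fun_ler.
Qed.

(** Sum [strip_le] over the d - 2 basis directions f orthogonal to z and e. The squares <f, y>^2 add
    up to 1 - <z, y>^2 - <e, y>^2, which is at least 1/2 unless |<z, y>| or |<e, y>| reaches 1/2;
    these two tails give the exponential term. *)
Lemma strip_mass_le z e : dot z z = 1 -> dot e e = 1 -> dot z e = 0 ->
  E (fun y => F (dot z y) (dot e y)) <=
  4 * d%:R * E (fun y => G (dot z y) (dot e y)) + 4 * expR (- (d%:R / 32)).
Proof.
move=> z1 e1 ze; pose i0 : 'I_d := Ordinal (ltnW d2); pose i1 : 'I_d := Ordinal d2.
have i01 : i0 != i1 by [].
rewrite !(@Ex_gram2 _ _ _ sigmaU z e (unitv i0) (unitv i1)) ?dot_unitvE ?eqxx//.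
have d0 : (0 < d)%N by exact: ltnW.
set x0 : d.-tuple R := unitv i0; set x1 : d.-tuple R := unitv i1.
have x01 : dot x0 x0 = 1 by rewrite dot_unitvE eqxx.
have x11 : dot x1 x1 = 1 by rewrite dot_unitvE eqxx.
pose RR := E (fun y => G (dot x0 y) (dot x1 y)); rewrite -/RR.
have h2 : 0 <= (1 / 2 : R) by lra.
have tl x : dot x x = 1 -> E (fun y => (1 / 2 <= `|dot x y|)%R%:R) <= 2 * expR (- (d%:R / 32)).
  move=> xx; apply: le_trans (abs_tail_le sigmaU d0 xx h2) _.
  by rewrite ler_pM2l// ler_expR lerN2 le_eqVlt; apply/predU1P; left; field.
have bt x : bmfun S (fun y => (1 / 2 <= `|dot x y|)%R%:R : R).
  apply: bmfun_ind; apply: measurable_fun_ler; first exact: measurable_cst.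
  by case: (bmfun_norm (bmfun_dot x)).
pose V j := fun y => F (dot x0 y) (dot x1 y) * (if (j == i0) || (j == i1) then 0 else dot (unitv j) y ^+ 2).
have bV j : bmfun S (V j).
  rewrite /V; case: ((j == i0) || (j == i1)); apply: bmfunM; try exact: bF.
    exact: bmfun_cst.
  exact/bmfunX/bmfun_dot.
have VRR j : E (V j) <= 2 * RR.
  rewrite /V; case: (boolP ((j == i0) || (j == i1))) => [_|].
    under eq_Rintegral do rewrite mulr0; rewrite Ex_cst// mulr_ge0//.
    apply: Ex_ge0 => y _; rewrite /G; case As: (A _); last by rewrite mul0r.
    by rewrite mul1r !mulr_ge0// ?subr_ge0 ?ler0n// lohi.
  rewrite negb_or => /andP[j0 j1].
  have := @strip_le _ _ _ sigmaU x0 x1 (unitv j) A lo hi.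
  by apply => //; rewrite dot_unitvE ?eqxx// eq_sym ?(negbTE j0) ?(negbTE j1)// eq_sym (negbTE i01).
have sumV : E (fun y => \sum_j V j y) <= 2 * d%:R * RR.
  rewrite Ex_sum//; apply: le_trans (ler_sum _ (fun j _ => VRR j)) _.
  by rewrite sumr_const card_ord -[leLHS]mulr_natr; lra.
apply: (@le_trans _ _ (E (fun y => 2 * (\sum_j V j y) +
    ((1 / 2 <= `|dot x0 y|)%R%:R + (1 / 2 <= `|dot x1 y|)%R%:R)))).
  have bS : bmfun S (fun y => \sum_j V j y) by exact: bmfun_sum.
  have b0 := bt x0; have b1 := bt x1.
  apply: Ex_le => // [|y Sy]; first by bmf.
  rewrite /V -mulr_sumr.
  have -> : \sum_j (if (j == i0) || (j == i1) then 0 else dot (unitv j) y ^+ 2) =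
     1 - dot x0 y ^+ 2 - dot x1 y ^+ 2.
    have : \sum_i tnth y i * tnth y i = 1 by exact: Sy.
    rewrite (bigD1 i0)//= (bigD1 i1)//= => yy.
    rewrite !dot_unitv !expr2 (bigD1 i0)//= (bigD1 i1)//=.
    rewrite -[1]yy (eq_bigr (fun j => tnth y j * tnth y j)); first ring.
    by move=> j /andP[/negbTE -> /negbTE ->]; rewrite /= dot_unitv expr2.
  have F01 : 0 <= F (dot x0 y) (dot x1 y) <= 1.
    by rewrite /F; case: (A _); case: (lo _ <= _ <= hi _); rewrite ?(mul0r, mulr0, mulr1) ?lexx ?ler01.
  move: F01; set ff := F _ _ => /andP[f0 f1].
  rewrite -[dot x0 y ^+ 2]real_normK ?num_real// -[dot x1 y ^+ 2]real_normK ?num_real//.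
  have n0 := normr_ge0 (dot x0 y); have n1 := normr_ge0 (dot x1 y).
  have m0 := cauchy_schwarz_unit x01 Sy; have m1 := cauchy_schwarz_unit x11 Sy.
  have s2 : `|dot x0 y| ^+ 2 + `|dot x1 y| ^+ 2 <= 1.
    rewrite !real_normK ?num_real// !dot_unitv.
    have : \sum_i tnth y i * tnth y i = 1 by exact: Sy.
    rewrite (bigD1 i0)//= (bigD1 i1)//= => <-.
    rewrite addrA -!expr2 lerDl; apply: sumr_ge0 => j _; rewrite -expr2; exact: sqr_ge0.
  have P1 : 0 <= 1 - `|dot x0 y| ^+ 2 - `|dot x1 y| ^+ 2 by lra.
  have ffP := mulr_ge0 f0 P1.
  case: (leP (1 / 2) `|dot x0 y|) => h0; first by rewrite /=; case: (1 / 2 <= _) => /=; lra.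
  case: (leP (1 / 2) `|dot x1 y|) => h1 /=; first by lra.
  have P2 : 0 <= 1 / 2 - `|dot x0 y| ^+ 2 - `|dot x1 y| ^+ 2 by nra.
  by have := mulr_ge0 f0 P2; lra.
have bS : bmfun S (fun y => \sum_j V j y) by exact: bmfun_sum.
have b0 := bt x0; have b1 := bt x1.
rewrite ExD//; [|by bmf|by bmf].
rewrite ExZl// ExD//.
have := tl _ x01; have := tl _ x11; lra.
Qed.

End strip_mass.

(** * Intersections of two caps *)

Section two_caps.
Context {R : realType} (d : nat).
Variable sigma : probability (d.-tuple R) R.
Hypothesis sigmaU : sphere_uniform sigma.
Hypothesis d2 : (2 <= d)%N.
Variables (p t : R).
Hypothesis p01 : 0 < p <= 1 / 2.
Hypothesis pt : is_threshold sigma p t.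
Implicit Types x y z e : d.-tuple R.

Local Notation S := (@sphere R d).
Local Notation E f := (Rintegral sigma S f).
Let mS : measurable S := @measurable_sphere R d.
Let sS : sigma S = 1%E := sigmaU.1.
Let d0 : (0 < d)%N := ltnW d2.
Let dR0 : 0 < d%:R :> R. Proof. by rewrite ltr0n. Qed.
Local Notation L := (ln (1 / p)).
Local Notation th := (Num.sqrt (L / d%:R)).

Definition cap x y : R := (t <= dot x y)%R%:R.

Definition cap2 x z := E (fun y => cap x y * cap z y).

Lemma cap01 x y : 0 <= cap x y <= 1.
Proof. by rewrite /cap; case: (t <= _); rewrite ?lexx ?ler01. Qed.

Lemma capC x y : cap x y = cap y x.
Proof. by rewrite /cap dotC. Qed.

Lemma bmfun_capl x : bmfun setT (cap x).
Proof.
apply: bmfun_ind; apply: measurable_fun_ler; first exact: measurable_cst.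
exact: measurable_dotr.
Qed.

Lemma bmfun_cap2 : bmfun setT (fun u : d.-tuple R * d.-tuple R => cap u.1 u.2).
Proof.
apply: bmfun_ind; apply: measurable_fun_ler; first exact: measurable_cst.
exact: measurable_dot.
Qed.

Lemma Ex_capl x : dot x x = 1 -> E (cap x) = p.
Proof.
by move=> x1; rewrite -(Ex_cap sigmaU pt x1); apply: eq_Ex => y _; rewrite /cap dotC.
Qed.

Lemma cap2_ge0 x z : 0 <= cap2 x z.
Proof.
apply: Ex_ge0 => y _; case/andP: (cap01 x y) => ? _; case/andP: (cap01 z y) => ? _.
exact: mulr_ge0.
Qed.

Lemma cap2_gram x z x' z' : dot x x = dot x' x' -> dot z z = dot z' z' ->
  dot x z = dot x' z' -> cap2 x z = cap2 x' z'.
Proof.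
move=> xx zz xz; have bx := bmfunT S (bmfun_capl x); have bz := bmfunT S (bmfun_capl z).
apply: (@Ex_gram2 _ _ _ sigmaU x z x' z' (fun a b => (t <= a)%R%:R * (t <= b)%R%:R)) => //.
exact: (bmfunM bx bz).
Qed.

(** For x = a z + sqrt(1 - a^2) e and s = <z, y>, the point y is in the cap of x iff <e, y> >=
    [al a s]. *)
Let al a s : R := (t - s * a) / Num.sqrt (1 - a ^+ 2).

Let al_lip a b s : `|a| <= 1 / 2 -> `|b| <= 1 / 2 ->
  `|al a s - al b s| <= 2 * `|a - b| * (`|t| + `|s|).
Proof.
move=> ha hb; have [_ /andP[a1 _]] := sqrt_1sub ha; have [_ /andP[b1 _]] := sqrt_1sub hb.
have := sqrt_1sub_lip ha hb; rewrite /al.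
set u := Num.sqrt _ in a1 *; set v := Num.sqrt _ in b1 * => uv.
have u0 : 0 < u by lra.
have v0 : 0 < v by lra.
have -> : (t - s * a) / u - (t - s * b) / v =
  (t * (v - u) - s * (a - b) * v + s * b * (u - v)) / (u * v).
  by field; rewrite !gt_eqF.
have w0 : 0 < u * v by exact: mulr_gt0.
rewrite normrM normfV (gtr0_norm w0) ler_pdivrMr//.
have n0 := normr_ge0 (a - b); have t0 := normr_ge0 t; have s0 := normr_ge0 s.
have T1 : `|t * (v - u)| <= `|t| * `|a - b| by rewrite normrM (distrC v u) ler_wpM2l.
have T2 : `|s * (a - b) * v| = `|s| * `|a - b| * v by rewrite !normrM (gtr0_norm v0).
have T3 : `|s * b * (u - v)| <= `|s| * (1 / 2) * `|a - b|.
  by rewrite !normrM ler_pM// ?mulr_ge0// ler_wpM2l.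
have uv1 : 36 / 49 <= u * v by nra.
have vuv : v <= 7 / 6 * (u * v) by nra.
apply: (@le_trans _ _ (`|t| * `|a - b| + `|s| * `|a - b| * v + `|s| * (1 / 2) * `|a - b|)).
  apply: le_trans (ler_normD _ _) _; apply: lerD => //.
  by apply: le_trans (ler_normD _ _) _; rewrite normrN T2 lerD2r.
set w := u * v in uv1 vuv *; set m := `|a - b| in n0 *.
have q1 := mulr_ge0 n0 t0; have q2 := mulr_ge0 n0 s0.
have : `|s| * m * v <= `|s| * m * (7 / 6 * w) by rewrite ler_wpM2l// mulr_ge0.
have w1 : 0 <= w - 36 / 49 by lra.
have := mulr_ge0 q1 w1; have := mulr_ge0 q2 w1; lra.
Qed.

Let al_le a s u : `|a| <= 1 / 2 ->
  (t <= a * s + Num.sqrt (1 - a ^+ 2) * u) = (al a s <= u).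
Proof.
move=> ha; have [_ /andP[a1 _]] := sqrt_1sub ha.
by rewrite /al ler_pdivrMr ?lerBlDr; [congr (_ <= _); ring|lra].
Qed.

Let lo a b s := Num.min (al a s) (al b s).
Let hi a b s := Num.max (al a s) (al b s).

(** Inside the cap of z the two intersections differ only on the strip between [al a] and [al b],
    whose width is O(|a - b| (|t| + |<z, y>|)). The strip estimate multiplies the width by d |<e,
    y>|. Width / |a - b| and |<e, y>| are both of order th there, which leaves d th^2 = L. The
    weight [g] lives on the union of the intersections, so their measures reappear on the right. *)
Lemma cap2_plane z e a b xa xb : dot z z = 1 -> dot e e = 1 -> dot z e = 0 ->
  `|a| <= 1 / 2 -> `|b| <= 1 / 2 ->
  xa = lincomb a z (Num.sqrt (1 - a ^+ 2)) e ->
  xb = lincomb b z (Num.sqrt (1 - b ^+ 2)) e ->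
  `|cap2 xa z - cap2 xb z| <=
    800 * L * `|a - b| * (cap2 xa z + cap2 xb z + p ^+ 2) + 4 * expR (- (d%:R / 32)).
Proof.
move=> z1 e1 ze ha hb xaE xbE.
have bca := bmfunT S (bmfun_capl xa); have bcb := bmfunT S (bmfun_capl xb).
have bcz := bmfunT S (bmfun_capl z); have bz := bmfun_dot z; have be := bmfun_dot e.
have bal c (x : d.-tuple R) : bmfun S (fun y => al c (dot x y)).
  by have bx := bmfun_dot x; rewrite /al; bmf.
have mA (x : d.-tuple R) : measurable_fun setT (fun y => t <= dot x y).
  by apply: measurable_fun_ler; [exact: measurable_cst|exact: measurable_dotr].
have blo x : bmfun S (fun y => lo a b (dot x y)) by apply: bmfun_min; exact: bal.
have bhi x : bmfun S (fun y => hi a b (dot x y)) by apply: bmfun_max; exact: bal.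
have lohi s : t <= s -> lo a b s <= hi a b s.
  by move=> _; rewrite /lo /hi le_max !ge_min lexx.
have := strip_mass_le sigmaU d2 (A := fun s => t <= s) mA blo bhi lohi z1 e1 ze.
set FF := E _; set GG := E _ => strip.
have dxa y : dot xa y = a * dot z y + Num.sqrt (1 - a ^+ 2) * dot e y by rewrite xaE dot_lincombl.
have dxb y : dot xb y = b * dot z y + Num.sqrt (1 - b ^+ 2) * dot e y by rewrite xbE dot_lincombl.
have D : `|cap2 xa z - cap2 xb z| <= FF.
  rewrite /cap2 -ExB//; [|by bmf|by bmf].
  apply: le_trans (Ex_norm mS sS _) _; first by bmf.
  apply: Ex_le => // [||y _]; [by bmf| |].
    have [ml _] := blo z; have [mh _] := bhi z; have [me _] := be.
    apply: bmfunM; first exact: bmfun_ind.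
    by apply: bmfun_ind; apply: measurable_and; apply: measurable_fun_ler.
  rewrite /cap dxa dxb !al_le//.
  case: (t <= dot z y); last by rewrite !mulr0 subr0 normr0 mul0r.
  rewrite !mulr1 mul1r /lo /hi ge_min le_max.
  by case: (leP (al a _)) => /= [_|/ltW ua]; case: (leP (al b _)) => /= [_|/ltW ub];
    rewrite ?ua ?ub ?orbT /= ?subrr ?subr0 ?sub0r ?normrN ?normr0 ?normr1 ?ler0n.
pose g y : R := (t <= dot z y)%R%:R * (lo a b (dot z y) <= dot e y)%R%:R.
have bg : bmfun S g.
  have [ml _] := blo z; have [me _] := be.
  apply: bmfunM; first exact: bmfun_ind.
  by apply: bmfun_ind; apply: measurable_fun_ler.
have g01 y : 0 <= g y <= 1.
  by rewrite /g; case: (t <= _); case: (lo _ _ _ <= _);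
    rewrite ?mulr1 ?mulr0 ?lexx ?ler01.
have Eg0 : 0 <= E g by apply: Ex_ge0 => y _; case/andP: (g01 y).
have Eg : E g <= cap2 xa z + cap2 xb z.
  rewrite /cap2 -ExD//; [|by bmf|by bmf].
  apply: Ex_le => // [|y _]; first by bmf.
  rewrite /g /cap dxa dxb !al_le// /lo ge_min.
  by case: (t <= dot z y); case: (leP (al a _)) => _; case: (leP (al b _)) => _;
    rewrite /= ?(mul1r, mulr1, mulr0, mul0r, addr0, add0r) ?lerDl ?ler0n.
(* 100 = 64 + 32 + 4, from <e, y>^2, half of <z, y>^2 and half of t^2. *)
have bp : `|a - b| * 2 * (th ^+ 2 * (100 * (E g + p ^+ 2))) >= GG.
  have m1 := moment2_le sigmaU d0 p01 e1 bg g01.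
  have m2 := moment2_le sigmaU d0 p01 z1 bg g01.
  have t2 := threshold_sqr_le sigmaU d0 p01 pt.
  apply: (@le_trans _ _ (E (fun y => `|a - b| * 2 *
     (g y * dot e y ^+ 2 + (1 / 2 * (g y * dot z y ^+ 2) + t ^+ 2 / 2 * g y))))).
    apply: Ex_le => // [||y _]; [| by bmf|].
      have [ml _] := blo z; have [me _] := be.
      have bl := blo z; have bh := bhi z.
      apply: bmfunM; first exact: bmfun_ind.
      apply: bmfunM; first by bmf.
      by apply: bmfun_ind; apply: measurable_fun_ler.
    rewrite /g; case: (t <= _); last by rewrite !mul0r !mulr0 !addr0 mulr0.
    case: (lo _ _ _ <= _); last by rewrite !(mul0r, mulr0, addr0).
    rewrite !mul1r !mulr1; set s := dot z y; set u := dot e y.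
    have -> : hi a b s - lo a b s = `|al a s - al b s|.
      by rewrite /hi /lo; case: (leP (al a s) (al b s)) => h;
        [rewrite distrC|]; rewrite ger0_norm// subr_ge0// ltW.
    have := ler_wpM2l (normr_ge0 u) (al_lip s ha hb).
    move/le_trans; apply.
    rewrite -[u ^+ 2]real_normK ?num_real// -[s ^+ 2]real_normK ?num_real//.
    rewrite -[t ^+ 2]real_normK ?num_real//.
    have := sqr_ge0 (`|u| - `|s|); have := sqr_ge0 (`|u| - `|t|) => q1 q2.
    rewrite (_ : `|u| * _ = `|a - b| * 2 * (`|u| * `|t| + `|u| * `|s|)); last ring.
    rewrite ler_wpM2l ?mulr_ge0//; lra.
  rewrite ExZl//; last by bmf.
  rewrite ler_wpM2l ?mulr_ge0//.
  rewrite ExD//; [|by bmf|by bmf].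
  rewrite ExD//; [|by bmf|by bmf].
  rewrite ExZl//.
  rewrite ExZl//; last by bmf.
  have := mulr_ge0 (sqr_ge0 th) Eg0; have := mulr_ge0 (sqr_ge0 th) (sqr_ge0 p).
  have : t ^+ 2 * E g <= 8 * th ^+ 2 * E g by rewrite ler_wpM2r.
  lra.
apply: (le_trans D); apply: (le_trans strip); rewrite lerD2r.
have dth : d%:R * th ^+ 2 = L.
  by rewrite (theta_sqr d p01) mulrC divfK// gt_eqF.
have L0 : 0 < L by have := ln_inv_ge p01; lra.
apply: (@le_trans _ _ (4 * d%:R * (`|a - b| * 2 * (th ^+ 2 * (100 * (E g + p ^+ 2)))))).
  by rewrite ler_wpM2l// mulr_ge0// ltW.
have -> : 4 * d%:R * (`|a - b| * 2 * (th ^+ 2 * (100 * (E g + p ^+ 2)))) =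
  800 * (d%:R * th ^+ 2) * `|a - b| * (E g + p ^+ 2) by ring.
rewrite dth; apply: ler_wpM2l; last by rewrite lerD2r.
by apply: mulr_ge0; [apply: mulr_ge0; [exact: ler0n|exact: ltW]|exact: normr_ge0].
Qed.

Lemma cap2_lip x x' z : dot x x = 1 -> dot x' x' = 1 -> dot z z = 1 ->
  `|dot x z| <= 1 / 2 -> `|dot x' z| <= 1 / 2 ->
  `|cap2 x z - cap2 x' z| <=
    800 * L * `|dot x z - dot x' z| * (cap2 x z + cap2 x' z + p ^+ 2) +
    4 * expR (- (d%:R / 32)).
Proof.
move=> x1 x1' z1 h h'; have [e [e1 ze xE]] := in_plane x1 z1 h.
have [b1 bz] := lincomb_unit z1 e1 ze h'.
have := cap2_plane z1 e1 ze h h' xE erefl.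
by rewrite (@cap2_gram (lincomb _ _ _ _) z x' z)// b1.
Qed.

Lemma Ex_cap2 z : dot z z = 1 -> E (fun x => cap2 x z) = p ^+ 2.
Proof.
move=> z1; have bc := bmfun_cap2; have bz := bmfun_capl z.
rewrite /cap2 (Ex_Fubini mS sS (F := fun u => cap u.1 u.2 * cap z u.2))/=; last first.
  apply: bmfunM => //.
  by apply: (@bmfun_comp _ _ _ _ _ (cap z) snd) => //; exact: measurable_snd.
rewrite (_ : p ^+ 2 = E (fun y => p * cap z y)); last first.
  by rewrite ExZl ?Ex_capl//; exact: bmfunT.
apply: eq_Ex => y Sy.
under eq_Rintegral do rewrite capC; rewrite ExZr ?Ex_capl//.
exact/bmfunT/bmfun_capl.
Qed.

(** [dlL] is 800 L (2 dl) <= 1/3: the coefficient in [cap2_lip] stays below 1 and the inequality can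
    be solved for one intersection measure. [etap] makes far points negligible against p^2, the mean
    of [cap2]. *)
Variable dl : R.
Hypothesis dl_gt0 : 0 < dl.
Hypothesis dl_half : dl <= 1 / 2.
Hypothesis dlL : 4800 * L * dl <= 1.
Local Notation eta := (expR (- (d%:R * dl ^+ 2 / 8))).
Hypothesis etap : 12 * eta <= p ^+ 2.

Lemma tail_eta x : dot x x = 1 ->
  E (fun y => (dl <= `|dot x y|)%R%:R) <= 2 * eta.
Proof. by move=> x1; apply: abs_tail_le => //; exact: ltW. Qed.

Lemma bmfun_tail x : bmfun S (fun y => (dl <= `|dot x y|)%R%:R : R).
Proof.
apply: bmfun_ind; apply: measurable_fun_ler; first exact: measurable_cst.
by case: (bmfun_norm (bmfun_dot x)).
Qed.

Let tail32 : expR (- (d%:R / 32)) <= eta.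
Proof. have q : dl ^+ 2 <= 1 / 4.
  by rewrite (_ : 1 / 4 = (1 / 2) ^+ 2); [rewrite lerXn2r// nnegrE ltW//; lra|field].
rewrite ler_expR lerN2 -[leLHS]mulrA; apply: ler_wpM2l; first exact: ltW.
by rewrite ler_pdivrMr//; lra. Qed.

Let dlw x z : `|dot x z| <= dl -> `|dot x z| <= 1 / 2.
Proof. by move/le_trans; apply. Qed.

Let L0 : 0 < L. Proof. by have := ln_inv_ge p01; lra. Qed.

Let dist2 x x' z : `|dot x z| <= dl -> `|dot x' z| <= dl ->
  800 * L * `|dot x z - dot x' z| <= 1 / 3.
Proof.
move=> h h'; have : `|dot x z - dot x' z| <= 2 * dl.
  by rewrite (le_trans (ler_normB _ _))//; lra.
by move=> /(ler_wpM2l (ltW L0)) H; have := dlL; lra.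
Qed.

(* Near orthogonality all intersections of two caps have comparable measures, and
   these average to p ^+ 2. *)
Lemma cap2_le x z : dot x x = 1 -> dot z z = 1 -> `|dot x z| <= dl ->
  cap2 x z <= 4 * p ^+ 2.
Proof.
move=> x1 z1 h; have bt := bmfun_tail z.
have bc2 : bmfun S (fun x => cap2 x z).
  have bz := bmfun_capl z; apply/bmfunT/(bmfun_Ex mS sS (F := fun u => cap u.1 u.2 * cap z u.2)).
  apply: bmfunM; first exact: bmfun_cap2.
  by apply: (@bmfun_comp _ _ _ _ _ (cap z) snd) => //; exact: measurable_snd.
have c0 := cap2_ge0 x z.
(* For far y the left side is 0. For near y the Lipschitz bound with coefficient at most 1/3
   rearranges to cap2 x z <= 2 cap2 y z + p^2 / 2 + 6 eta. *)
have : E (fun y => cap2 x z * (1 - (dl <= `|dot z y|)%R%:R)) <=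
    E (fun y => 2 * cap2 y z + (p ^+ 2 / 2 + 6 * eta)).
  apply: Ex_le => // [||y Sy]; [by bmf|by bmf|].
  have cy0 := cap2_ge0 y z; have p2 := sqr_ge0 p; have e0 := expR_ge0 (- (d%:R * dl ^+ 2 / 8)).
  case: (leP dl) => [_|yz] /=; first by rewrite subrr mulr0; lra.
  rewrite subr0 mulr1.
  have yz' : `|dot y z| <= dl by rewrite dotC ltW.
  have := cap2_lip x1 Sy z1 (dlw h) (dlw yz'); have := dist2 h yz'.
  set q := 800 * L * _ => q3 H.
  have : q * (cap2 x z + cap2 y z + p ^+ 2) <= 1 / 3 * (cap2 x z + cap2 y z + p ^+ 2).
    by rewrite ler_wpM2r// !addr_ge0.
  have := tail32; have := ler_norm (cap2 x z - cap2 y z); lra.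
rewrite ExZl//; last by bmf.
rewrite ExB//; last by bmf.
rewrite Ex_cst// ExD//; [|by bmf|by bmf].
rewrite Ex_cst// ExZl// Ex_cap2//.
have := tail_eta z1; set q := E _; have := etap => e12 e2.
have p2 : p ^+ 2 <= 1 / 4 by case/andP: p01 => *; nra.
have : cap2 x z * q <= cap2 x z * (1 / 24) by rewrite ler_wpM2l//; lra.
lra.
Qed.

Lemma cap2_near_lip x x' z : dot x x = 1 -> dot x' x' = 1 -> dot z z = 1 ->
  `|dot x z| <= dl -> `|dot x' z| <= dl ->
  `|cap2 x z - cap2 x' z| <= 7200 * L * p ^+ 2 * `|dot x z - dot x' z| + 4 * eta.
Proof.
move=> x1 x1' z1 h h'; apply: le_trans (cap2_lip x1 x1' z1 (dlw h) (dlw h')) _.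
apply: lerD; last by rewrite ler_pM2l.
have c := cap2_le x1 z1 h; have c' := cap2_le x1' z1 h'.
have n0 := normr_ge0 (dot x z - dot x' z).
rewrite (_ : 7200 * L * p ^+ 2 * `|dot x z - dot x' z| =
  800 * L * `|dot x z - dot x' z| * (9 * p ^+ 2)); last ring.
apply: ler_wpM2l; last by lra.
by apply: mulr_ge0; [apply: mulr_ge0; [exact: ler0n|exact: ltW]|exact: normr_ge0].
Qed.

End two_caps.

(** * Powers of the centred cap kernel *)

(** 7200 is the constant of [cap2_near_lip]; 132 and 8 are the factors of [near_lipS], where 2^j
    comes from the crude bound (2 p)^j. *)
Fixpoint lip_const {R : realType} (j : nat) : R :=
  if j is i.+1 then 132 * lip_const i + 8 * 2 ^+ j else 7200.

Lemma lip_const_ge {R : realType} j : 0 <= lip_const j :> R.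
Proof.
elim: j => [|j IHj]; first exact: ler0n.
by apply: addr_ge0; apply: mulr_ge0; rewrite ?IHj ?exprn_ge0 ?ler0n.
Qed.

Section kernels.
Context {R : realType} (d : nat).
Variable sigma : probability (d.-tuple R) R.
Hypothesis sigmaU : sphere_uniform sigma.
Hypothesis d2 : (2 <= d)%N.
Variables (p t : R).
Hypothesis p01 : 0 < p <= 1 / 2.
Hypothesis pt : is_threshold sigma p t.
Implicit Types x y z e : d.-tuple R.

Local Notation S := (@sphere R d).
Local Notation E f := (Rintegral sigma S f).
Let mS : measurable S := @measurable_sphere R d.
Let sS : sigma S = 1%E := sigmaU.1.
Let d0 : (0 < d)%N := ltnW d2.
Local Notation L := (ln (1 / p)).
Local Notation th := (Num.sqrt (L / d%:R)).
Local Notation cap := (cap t).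

Let p0 : 0 < p. Proof. by case/andP: p01. Qed.
Let p2 : p <= 1 / 2. Proof. by case/andP: p01. Qed.
Let L0 : 0 < L. Proof. by have := ln_inv_ge p01; lra. Qed.

Definition wedge x y : R := cap x y - p.

(* The kernel of the (j + 1)-st power of the integral operator with kernel
   [wedge]. *)
Fixpoint ker j x z : R :=
  if j is i.+1 then E (fun y => ker i x y * wedge y z) else wedge x z.

Lemma bmfun_wedge : bmfun setT (fun u : d.-tuple R * d.-tuple R => wedge u.1 u.2).
Proof. by apply: bmfunD; [exact: bmfun_cap2|exact: bmfun_cst]. Qed.

Lemma bmfun_ker j : bmfun setT (fun u : d.-tuple R * d.-tuple R => ker j u.1 u.2).
Proof.
elim: j => [|j IHj]; first exact: bmfun_wedge.
apply: (bmfun_Ex mS sS (F := fun v : (d.-tuple R * d.-tuple R) * d.-tuple R =>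
  ker j v.1.1 v.2 * wedge v.2 v.1.2)).
have m11 : measurable_fun setT (fun v : (d.-tuple R * d.-tuple R) * d.-tuple R => v.1.1).
  by apply: (measurableT_comp measurable_fst measurable_fst).
have m12 : measurable_fun setT (fun v : (d.-tuple R * d.-tuple R) * d.-tuple R => v.1.2).
  by apply: (measurableT_comp measurable_snd measurable_fst).
apply: bmfunM.
  apply: (@bmfun_comp _ _ _ _ _ (fun u => ker j u.1 u.2) (fun v => (v.1.1, v.2))) => //.
  by apply/measurable_fun_pair => //; exact: measurable_snd.
apply: (@bmfun_comp _ _ _ _ _ (fun u => wedge u.1 u.2) (fun v => (v.2, v.1.2))).
  by apply/measurable_fun_pair => //; exact: measurable_snd.
exact: bmfun_wedge.
Qed.

Lemma bmfun_kerl j x D : bmfun D (ker j x).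
Proof. exact: (bmfun_pair1 x D (bmfun_ker j)). Qed.

Lemma bmfun_wedgel x D : bmfun D (wedge x).
Proof. exact: (bmfun_pair1 x D bmfun_wedge). Qed.

Lemma bmfun_wedger z D : bmfun D (fun x => wedge x z).
Proof. exact: (bmfun_pair2 z D bmfun_wedge). Qed.

Lemma wedge_le1 x y : `|wedge x y| <= 1.
Proof.
by rewrite ler_norml /wedge; have /andP[] := cap01 t x y; have := p0; have := p2; lra.
Qed.

Lemma Ex_capr z : dot z z = 1 -> E (fun y => cap y z) = p.
Proof. exact: Ex_cap. Qed.

Lemma bmfun_capr z D : bmfun D (fun y => cap y z).
Proof. exact: bmfun_cap. Qed.

(** The crude bound that serves for far points: [wedge] has L^1 norm at most 2 p in either
    variable. *)
Lemma ker_le j x z : dot z z = 1 -> `|ker j x z| <= (2 * p) ^+ j.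
Proof.
elim: j x z => [|j IHj] x z z1; first by rewrite expr0 wedge_le1.
have bk := bmfun_kerl j x S; have bw := bmfun_wedger z S; have bc := bmfun_capr z S.
apply: le_trans (Ex_norm mS sS _) _; first by bmf.
apply: (@le_trans _ _ (E (fun y => (2 * p) ^+ j * (cap y z + p)))).
  apply: Ex_le => // [||y Sy]; [by bmf|by bmf|].
  rewrite normrM ler_pM//; first exact: IHj.
  by rewrite ler_norml /wedge; have /andP[] := cap01 t y z; have := p0; lra.
rewrite ExZl//; try by bmf.
rewrite ExD//; last by bmf.
rewrite Ex_cst// Ex_capr// exprSr le_eqVlt; apply/predU1P; left; ring.
Qed.

Lemma Ex_wedge x : dot x x = 1 -> E (wedge x) = 0.
Proof.
move=> x1; have bc := bmfunT S (bmfun_capl t x).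
by rewrite /wedge ExB ?Ex_cst ?(Ex_capl sigmaU pt)// ?subrr//; bmf.
Qed.

Lemma Ex_ker j x : dot x x = 1 -> E (ker j x) = 0.
Proof.
case: j => [|j] x1; first exact: Ex_wedge.
transitivity (E (fun z => E (fun y => ker j x y * wedge y z))); first by [].
rewrite (Ex_Fubini mS sS (F := fun u => ker j x u.2 * wedge u.2 u.1)) /=.
  rewrite -[RHS](Ex_cst mS sS); apply: eq_Ex => y Sy.
  by rewrite ExZl ?Ex_wedge ?mulr0//; exact: bmfun_wedgel.
apply: bmfunM.
  by apply: (@bmfun_comp _ _ _ _ _ (ker j x) snd); [exact: measurable_snd|exact: bmfun_kerl].
exact: (bmfun_swap bmfun_wedge).
Qed.

(** As the kernel has mean zero, the cap may replace its centred version. The integral then lives on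
    a set of measure p, the source of one factor p per step. *)
Lemma Ex_ker_cap j x z : dot x x = 1 -> ker j.+1 x z = E (fun y => ker j x y * cap y z).
Proof.
move=> x1; have bk := bmfun_kerl j x S; have bc := bmfun_capr z S.
transitivity (E (fun y => ker j x y * cap y z - ker j x y * p)).
  by apply: eq_Ex => y _; rewrite /wedge mulrBr.
rewrite ExB//; [|by bmf|by bmf].
by rewrite ExZr// Ex_ker// mul0r subr0.
Qed.

Lemma ker_mxapp j M x z : orthogonal_mx M -> ker j (mxapp M x) (mxapp M z) = ker j x z.
Proof.
move=> OM; elim: j x z => [|j IHj] x z; first by rewrite /= /wedge /cap dot_mxapp.
rewrite /= -(Ex_mxapp sigmaU OM); last first.
  by apply: bmfunM; [exact: bmfun_kerl|exact: bmfun_wedger].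
by apply: eq_Ex => y _; rewrite IHj /wedge /cap dot_mxapp.
Qed.

Lemma ker_gram j x z x' z' : dot x x = dot x' x' -> dot z z = dot z' z' ->
  dot x z = dot x' z' -> ker j x z = ker j x' z'.
Proof.
move=> xx zz xz; have [|M OM Mx] := @gram_orthogonal _ _ 2 (nth x [:: x; z]) (nth x' [:: x'; z']).
  by move=> [|[|i]] [|[|j']] //= _ _; rewrite // dotC xz dotC.
by rewrite -(ker_mxapp j x z OM) (Mx 0%N)// (Mx 1%N).
Qed.

Lemma ker1E x z : dot x x = 1 -> dot z z = 1 -> ker 1 x z = cap2 sigma t x z - p ^+ 2.
Proof.
move=> x1 z1; rewrite Ex_ker_cap// /cap2 /= /wedge.
have bx := bmfunT S (bmfun_capl t x); have bz := bmfun_capr z S.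
transitivity (E (fun y => cap x y * cap y z - p * cap y z)).
  by apply: eq_Ex => y _; ring.
rewrite ExB//; [|by bmf|by bmf].
rewrite ExZl// Ex_capr// -expr2; congr (_ - _).
by apply: eq_Ex => y _; rewrite (capC t z).
Qed.

Lemma Ex_cap_dot x z : dot x x = 1 -> dot z z = 1 ->
  E (fun y => cap y z * `|dot x y|) <= 66 * th * p.
Proof.
move=> x1 z1; apply: le_trans (moment1_le sigmaU d0 p01 x1 (bmfun_capr z S) _) _.
  by move=> y; exact: cap01.
rewrite Ex_capr//; have := theta_gt0 d0 p01; have := p0; have := p2.
set s := th => q1 q2 q3; have : p ^+ 2 <= p by nra.
move=> q4; have := ler_wpM2l (ltW q3) q4; lra.
Qed.

Lemma Ex_abs_dot x : dot x x = 1 -> E (fun y => `|dot x y|) <= 66 * th.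
Proof.
move=> x1; have := moment1_le sigmaU d0 p01 x1 (bmfun_cst S 1).
rewrite Ex_cst// => /(_ (fun=> _)).
under eq_Rintegral do rewrite mul1r.
move=> H; apply: le_trans (H _) _; first by rewrite ler01 lexx.
have := theta_gt0 d0 p01; have := p0; have := p2.
set s := th => q1 q2 q3; have : p ^+ 2 <= 1 by nra.
move=> q4; have := ler_wpM2l (ltW q3) q4; lra.
Qed.

Variable dl : R.
Hypothesis dl_gt0 : 0 < dl.
Hypothesis dl_half : dl <= 1 / 2.
Hypothesis dlL : 4800 * L * dl <= 1.
Local Notation eta := (expR (- (d%:R * dl ^+ 2 / 8))).
Hypothesis etap : 12 * eta <= p ^+ 2.

Let far x y : R := (dl <= `|dot x y|)%R%:R.

Let far0 x y : 0 <= far x y. Proof. exact: ler0n. Qed.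

Let bfar x : bmfun S (far x). Proof. exact: bmfun_tail. Qed.

Let Efar x : dot x x = 1 -> E (far x) <= 2 * eta.
Proof. exact: tail_eta. Qed.

(** B collects the contributions of exponentially rare points, which prevent a true Lipschitz
    bound. *)
Definition near_lip j (A B : R) := forall x x' z,
  dot x x = 1 -> dot x' x' = 1 -> dot z z = 1 ->
  `|dot x z| <= dl -> `|dot x' z| <= dl ->
  `|ker j x z - ker j x' z| <= A * `|dot x z - dot x' z| + B.

Let near_lip_all j A B x x' z : near_lip j A B -> 0 <= A -> 0 <= B ->
  dot x x = 1 -> dot x' x' = 1 -> dot z z = 1 ->
  `|ker j x z - ker j x' z| <=
    A * `|dot x z - dot x' z| + B + 2 * (2 * p) ^+ j * (far x z + far x' z).
Proof.
move=> lip A0 B0 x1 x1' z1.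
have e0 : 0 <= (2 * p) ^+ j by rewrite exprn_ge0// mulr_ge0// ltW.
have AB0 : 0 <= A * `|dot x z - dot x' z| + B by rewrite addr_ge0// mulr_ge0.
have k2 : `|ker j x z - ker j x' z| <= 2 * (2 * p) ^+ j.
  rewrite (le_trans (ler_normB _ _))//.
  have := ker_le j x z1; have := ker_le j x' z1; lra.
rewrite /far; case: (leP dl) => [_|xz] /=.
  by case: (dl <= _) => /=; lra.
case: (leP dl) => [_|xz'] /=; first by lra.
by have := lip _ _ _ x1 x1' z1 (ltW xz) (ltW xz'); lra.
Qed.

(** Replace x' by x'' in the plane of x and z and apply the bound for j with y as the fixed point.
    Then <x - x'', y> is at most |<x, z> - <x', z>| times |<z, y>| + |<e, y>|, and each of these has
    integral at most 66 th p over the cap of z: 132 = 66 + 66. The y far from x or x'' have total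
    mass at most 4 eta and cost 2 (2 p)^j each. *)
Lemma near_lipS j A B : near_lip j A B -> 0 <= A -> 0 <= B ->
  near_lip j.+1 (132 * A * th * p) (B * p + 8 * (2 * p) ^+ j * eta).
Proof.
move=> lip A0 B0 x x' z x1 x1' z1 h h'.
have hw x0 : `|dot x0 z| <= dl -> `|dot x0 z| <= 1 / 2 by move/le_trans; apply.
have [e [x'' [e1 x1'' x''z xx'']]] := move_in_plane x1 z1 (hw _ h) (hw _ h').
rewrite -[ker _ x' z](ker_gram j.+1 (x := x'') (z := z)) ?x1 ?x1' ?x1''//.
rewrite !Ex_ker_cap//; have bk := bmfun_kerl j x S; have bk' := bmfun_kerl j x'' S.
have bc := bmfun_capr z S; have bz := bmfun_dot z; have be := bmfun_dot e.
have bf := bfar x; have bf' := bfar x''.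
rewrite -ExB//; [|by bmf|by bmf].
apply: le_trans (Ex_norm mS sS _) _; first by bmf.
set m := `|dot x z - dot x' z|; have m0 : 0 <= m by exact: normr_ge0.
have e0 : 0 <= (2 * p) ^+ j by rewrite exprn_ge0// mulr_ge0// ltW.
apply: (@le_trans _ _ (E (fun y =>
  A * m * (cap y z * `|dot z y| + cap y z * `|dot e y|) + B * cap y z +
  2 * (2 * p) ^+ j * (far x y + far x'' y)))).
  apply: Ex_le => // [||y Sy]; [by bmf|by bmf|].
  rewrite -mulrBl normrM.
  have := near_lip_all lip A0 B0 x1 x1'' (Sy : dot y y = 1).
  have := ler_wpM2l A0 (xx'' y); rewrite -/m => q1 q2.
  have /andP[c0 c1] := cap01 t y z; rewrite [`|cap y z|]ger0_norm//.
  set c := cap y z in c0 c1 *; set K := `|_ - _| in q2 *; set D := `|dot x y - _| in q1 q2.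
  have ff : 0 <= 2 * (2 * p) ^+ j * (far x y + far x'' y).
    by rewrite !mulr_ge0// addr_ge0.
  have q3 : K <= A * (m * (`|dot z y| + `|dot e y|)) + B +
      2 * (2 * p) ^+ j * (far x y + far x'' y) by lra.
  apply: le_trans (ler_wpM2r c0 q3) _.
  have := ler_wpM2l ff c1; lra.
rewrite ExD//; try by bmf.
rewrite ExD//; try by bmf.
rewrite !ExZl//; try by bmf.
rewrite !ExD//; try by bmf.
rewrite Ex_capr//.
have q1 := Ex_cap_dot z1 z1; have q2 := Ex_cap_dot e1 z1.
have q3 := Efar x1; have q4 := Efar x1''.
have Am0 : 0 <= A * m by exact: mulr_ge0.
have := ler_wpM2l Am0 (lerD q1 q2); have := ler_wpM2l e0 (lerD q3 q4).
lra.
Qed.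

(** [ker j.+1] belongs to T^(j + 2): the induction starts at T^2, with one factor p for each T and
    one th for each step after T^2. *)
Lemma near_lip_ker j : near_lip j.+1
  (lip_const j * (L * p ^+ j.+2 * th ^+ j)) (lip_const j * (p ^+ j * eta)).
Proof.
have e0 := expR_ge0 (- (d%:R * dl ^+ 2 / 8)).
have tp : 0 < th := theta_gt0 d0 p01.
elim: j => [|j IHj].
  move=> x x' z x1 x1' z1 h h'; rewrite !ker1E// opprB addrA subrK.
  apply: le_trans (cap2_near_lip sigmaU d2 p01 pt dl_gt0 dl_half dlL etap x1 x1' z1 h h') _.
  rewrite [lip_const 0]/= !expr0; apply: lerD.
    by rewrite le_eqVlt; apply/predU1P; left; ring.
  by rewrite (mul1r (expR _)); apply: ler_wpM2r => //; rewrite ler_nat.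
have c0 : 0 <= lip_const j :> R := lip_const_ge j.
have q1 : 0 <= L * p ^+ j.+2 * th ^+ j.
  by apply: mulr_ge0; [apply: mulr_ge0; [exact: ltW|apply/exprn_ge0/ltW]|apply/exprn_ge0/ltW].
have q2 : 0 <= p ^+ j * eta by apply: mulr_ge0 => //; apply/exprn_ge0/ltW.
have := near_lipS IHj (mulr_ge0 c0 q1) (mulr_ge0 c0 q2).
move=> lip x x' z x1 x1' z1 h h'; apply: le_trans (lip _ _ _ x1 x1' z1 h h') _.
have pj : 0 <= p ^+ j.+1 by apply/exprn_ge0/ltW.
have twoj : 0 <= 2 ^+ j.+1 :> R by exact: exprn_ge0.
rewrite [lip_const j.+1]/=; apply: lerD.
  apply: ler_wpM2r; first exact: normr_ge0.
  have -> : 132 * (lip_const j * (L * p ^+ j.+2 * th ^+ j)) * th * p =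
    132 * lip_const j * (L * p ^+ j.+3 * th ^+ j.+1).
    by rewrite (exprS p j.+2) (exprS th j); ring.
  apply: ler_wpM2r.
    by apply: mulr_ge0; [apply: mulr_ge0; [exact: ltW|apply/exprn_ge0/ltW]|apply/exprn_ge0/ltW].
  by rewrite lerDl mulr_ge0.
have -> : lip_const j * (p ^+ j * eta) * p = lip_const j * (p ^+ j.+1 * eta).
  by rewrite (exprS p j); ring.
rewrite exprMn (_ : 8 * (2 ^+ j.+1 * p ^+ j.+1) * eta = 8 * 2 ^+ j.+1 * (p ^+ j.+1 * eta)); last by ring.
rewrite -mulrDl; apply: ler_wpM2r; first exact: mulr_ge0.
by rewrite lerD2r; have := c0; lra.
Qed.

Lemma exists_orthogonal x : dot x x = 1 -> exists2 e, dot e e = 1 & dot x e = 0.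
Proof.
move=> x1; pose i0 : 'I_d := Ordinal d0; pose i1 : 'I_d := Ordinal d2.
have [|M OM Mx] := @gram_orthogonal _ _ 1 (fun=> unitv i0) (fun=> x).
  by move=> i j _ _; rewrite dot_unitvE eqxx x1.
exists (mxapp M (unitv i1)); first by rewrite dot_mxapp// dot_unitvE eqxx.
by rewrite -(Mx 0%N)// dot_mxapp// dot_unitvE.
Qed.

(** The diagonal is far from orthogonality, beyond the reach of the Lipschitz bound. But one more T
    writes it as an integral of [ker j.+1 x y] over the cap around x, where <x, y> is still of order
    th. The value c at an orthogonal pair is split off, and mean zero makes c small. *)
Lemma ker_diag_le j x : dot x x = 1 ->
  `|ker j.+2 x x| <= lip_const j.+1 * (L * p ^+ j.+3 * th ^+ j.+1 + p ^+ j.+1 * eta).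
Proof.
move=> x1; have [e e1 xe] := exists_orthogonal x1.
set A := lip_const j * (L * p ^+ j.+2 * th ^+ j); set B := lip_const j * (p ^+ j * eta).
have e0 := expR_ge0 (- (d%:R * dl ^+ 2 / 8)).
have tp : 0 < th := theta_gt0 d0 p01.
have c0 : 0 <= lip_const j :> R := lip_const_ge j.
have q1 : 0 <= L * p ^+ j.+2 * th ^+ j.
  by apply: mulr_ge0; [apply: mulr_ge0; [exact: ltW|apply/exprn_ge0/ltW]|apply/exprn_ge0/ltW].
have q2 : 0 <= p ^+ j * eta by apply: mulr_ge0 => //; apply/exprn_ge0/ltW.
have A0 : 0 <= A by exact: mulr_ge0.
have B0 : 0 <= B by exact: mulr_ge0.
have lip := @near_lip_ker j; rewrite -/A -/B in lip.
pose c := ker j.+1 x e.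
set T := 2 * (2 * p) ^+ j.+1.
have T0 : 0 <= T by rewrite mulr_ge0// exprn_ge0// mulr_ge0// ltW.
have D y : S y -> `|ker j.+1 x y - c| <= A * `|dot x y| + B + T * far x y.
  move=> Sy; have y1 : dot y y = 1 by [].
  (* [near_lip] moves the first argument, here the second one moves; symmetry exchanges them. *)
  rewrite /c (ker_gram _ (x := x) (z := y) (x' := y) (z' := x)) ?x1 ?y1//; last exact: dotC.
  rewrite (ker_gram _ (x := x) (z := e) (x' := e) (z' := x)) ?x1 ?e1//; last exact: dotC.
  have := near_lip_all lip A0 B0 y1 e1 x1.
  rewrite (dotC e x) xe subr0 (dotC y x) /far (dotC e x) xe normr0 (dotC y x).
  by rewrite (lt_geF dl_gt0) addr0.
have bk := bmfun_kerl j.+1 x S; have bc := bmfun_capr x S; have bx := bmfun_dot x.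
have bf := bfar x.
have c_le : `|c| <= A * (66 * th) + B + T * (2 * eta).
  have -> : c = - E (fun y => ker j.+1 x y - c).
    rewrite ExB//; last by bmf.
    by rewrite Ex_ker// Ex_cst// sub0r opprK.
  rewrite normrN; apply: le_trans (Ex_norm mS sS _) _; first by bmf.
  apply: (@le_trans _ _ (E (fun y => A * `|dot x y| + B + T * far x y))).
    by apply: Ex_le => //; bmf.
  rewrite ExD//; try by bmf.
  rewrite ExD//; try by bmf.
  rewrite Ex_cst// ExZl//; last by bmf.
  rewrite ExZl//; apply: lerD; last by apply: ler_wpM2l => //; exact: Efar.
  by rewrite lerD2r; apply: ler_wpM2l => //; exact: Ex_abs_dot.
have k_le : `|E (fun y => (ker j.+1 x y - c) * cap y x)| <=
    A * (66 * th * p) + B * p + T * (2 * eta).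
  apply: le_trans (Ex_norm mS sS _) _; first by bmf.
  apply: (@le_trans _ _ (E (fun y => A * (cap y x * `|dot x y|) + B * cap y x + T * far x y))).
    apply: Ex_le => // [||y Sy]; [by bmf|by bmf|].
    have /andP[y0 y1] := cap01 t y x; rewrite normrM [`|cap y x|]ger0_norm//.
    apply: le_trans (ler_wpM2r y0 (D _ Sy)) _.
    have := ler_wpM2l (mulr_ge0 T0 (far0 x y)) y1; lra.
  rewrite ExD//; try by bmf.
  rewrite ExD//; try by bmf.
  rewrite !ExZl//; try by bmf.
  rewrite Ex_capr//; apply: lerD; last by apply: ler_wpM2l => //; exact: Efar.
  by rewrite lerD2r; apply: ler_wpM2l => //; exact: Ex_cap_dot.
have -> : ker j.+2 x x = E (fun y => (ker j.+1 x y - c) * cap y x) + c * p.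
  rewrite Ex_ker_cap//.
  transitivity (E (fun y => (ker j.+1 x y - c) * cap y x + c * cap y x)).
    by apply: eq_Ex => y _; ring.
  rewrite ExD//; try by bmf.
  by rewrite ExZl// Ex_capr.
apply: le_trans (ler_normD _ _) _; rewrite normrM (gtr0_norm p0).
apply: le_trans (lerD k_le (ler_wpM2r (ltW p0) c_le)) _.
have Te : T * (2 * eta) * p <= T * (2 * eta).
  have Te0 : 0 <= T * (2 * eta) by apply: mulr_ge0 => //; apply: mulr_ge0.
  by rewrite ler_piMr//; have := p2; lra.
have -> : lip_const j.+1 = 132 * lip_const j + 8 * 2 ^+ j.+1 :> R by [].
have T_E : T * (2 * eta) = 4 * (2 ^+ j.+1 * (p ^+ j.+1 * eta)).
  by rewrite /T exprMn; ring.
have A_E : A * (66 * th * p) = 66 * (lip_const j * (L * p ^+ j.+3 * th ^+ j.+1)).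
  by rewrite /A (exprS p j.+2) (exprS th j); ring.
have B_E : B * p = lip_const j * (p ^+ j.+1 * eta).
  by rewrite /B (exprS p j); ring.
set X := L * p ^+ j.+3 * th ^+ j.+1 in A_E *; set Y := p ^+ j.+1 * eta in T_E B_E *.
have X0 : 0 <= X.
  by apply: mulr_ge0; [apply: mulr_ge0; [exact: ltW|apply/exprn_ge0/ltW]|apply/exprn_ge0/ltW].
have Y0 : 0 <= Y by apply: mulr_ge0 => //; apply/exprn_ge0/ltW.
have two0 : 0 <= 2 ^+ j.+1 :> R by exact: exprn_ge0.
have := mulr_ge0 c0 X0; have := mulr_ge0 c0 Y0; have := mulr_ge0 two0 X0.
have := mulr_ge0 two0 Y0; lra.
Qed.

End kernels.

(** * Signed cycle counts *)

Section edges.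
Context {R : realType} (n : nat).
Implicit Types (q : {set 'I_n} -> R) (H : {set {set 'I_n}}).

Lemma expect_indep_prod q (g : {set 'I_n} -> bool -> R) :
  expect (indep_edges q) (fun G => \prod_(e in pairs n) g e (e \in G)) =
  \prod_(e in pairs n) (q e * g e true + (1 - q e) * g e false).
Proof.
rewrite [RHS]big_mkcond /=.
(* Outside [pairs n] the values 0 (present) and 1 (absent) discard the sets that are not graphs and
   add no factor to the others. *)
pose F e : R := if e \in pairs n then q e * g e true else 0.
pose F' e : R := if e \in pairs n then (1 - q e) * g e false else 1.
rewrite (eq_bigr (fun e => F e + F' e)) => [|e _]; last first.
  by rewrite /F /F'; case: ifP; rewrite ?add0r.
rewrite bigA_distr /expect [LHS]big_mkcond [RHS]big_mkcond; apply: eq_bigr => J _.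
rewrite powersetE /=; case: (boolP (J \subset pairs n)) => JP; last first.
  have [e eJ eP] := subsetPn JP.
  by rewrite (bigD1 e)//= eJ /F (negbTE eP) mul0r.
rewrite -big_split/= big_mkcond; apply: eq_bigr => e _; rewrite /F /F'.
case: (boolP (e \in pairs n)) => [_|eP]; first by case: (e \in J).
by rewrite ifN//; apply: contra eP => /(fintype.subsetP JP).
Qed.

Lemma expect_indep_sub q H (g : {set 'I_n} -> bool -> R) : H \subset pairs n ->
  expect (indep_edges q) (fun G => \prod_(e in H) g e (e \in G)) =
  \prod_(e in H) (q e * g e true + (1 - q e) * g e false).
Proof.
move=> /fintype.subsetP HP; have H0 := expect_indep_prod q (fun e b => if e \in H then g e b else 1).
have sub (f : {set 'I_n} -> R) : \prod_(e in pairs n) (if e \in H then f e else 1) = \prod_(e in H) f e.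
  rewrite big_mkcond [RHS]big_mkcond; apply: eq_bigr => e _.
  by case: ifP => // eP; case: ifP => // /HP; rewrite eP.
transitivity (expect (indep_edges q)
    (fun G => \prod_(e in pairs n) (if e \in H then g e (e \in G) else 1))).
  by congr expect; apply/funext => G; rewrite (sub (fun e => g e (e \in G))).
rewrite H0 -(sub (fun e => q e * g e true + (1 - q e) * g e false)).
by apply: eq_bigr => e _; case: ifP => // _; ring.
Qed.

Lemma expect_sum m I (s : seq I) (P : pred I) (f : I -> {set {set 'I_n}} -> R) :
  expect m (fun G => \sum_(i <- s | P i) f i G) = \sum_(i <- s | P i) expect m (f i).
Proof.
rewrite /expect exchange_big /=; apply: eq_bigr => G _.
by rewrite mulr_sumr.
Qed.

End edges.

(** * Cycles as sets of edges *)

Section cycle_edges.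
Variables (n l : nat).
Hypothesis l3 : (3 <= l)%N.
Implicit Types t : l.-tuple 'I_n.

Lemma ordS_neq (i : 'I_l) : ordS i != i.
Proof.
apply/eqP => /(congr1 val) /=; have [il|] := ltnP i.+1 l.
  by rewrite modn_small// => /eqP; rewrite gtn_eqF.
rewrite leq_eqVlt ltnS leqNgt ltn_ord orbF => /eqP il.
by rewrite [X in (_ %% X)%N]il modnn => i0; have := l3; rewrite [X in (_ < X)%N]il -i0.
Qed.

Lemma ordSS_neq (i : 'I_l) : ordS (ordS i) != i.
Proof.
apply/eqP => /(congr1 val) /=; rewrite -[X in (X %% l)%N]addn1 modnDml addn1.
have := ltn_ord i; case: (ltnP i.+2 l) => [il|].
  by rewrite modn_small// => _ /eqP; rewrite gtn_eqF// ltnW.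
move=> li il; have h : (i.+2 - l < l)%N by lia.
by rewrite -(subnK li) modnDr modn_small// => e; lia.
Qed.

(** Two positions with the same edge would force [ordS (ordS j) = j], excluded by l >= 3. *)
Lemma cycle_edge_inj t : uniq t ->
  injective (fun i : 'I_l => [set tnth t i; tnth t (ordS i)]%SET).
Proof.
move=> /tuple_uniqP tI i j /= E.
have : tnth t i \in [set tnth t j; tnth t (ordS j)]%SET by rewrite -E !inE eqxx.
rewrite !inE !(inj_eq tI) => /orP[/eqP//|/eqP ij].
have : tnth t (ordS i) \in [set tnth t j; tnth t (ordS j)]%SET.
  by rewrite -E !inE eqxx orbT.
rewrite !inE !(inj_eq tI) ij (inj_eq (@ordS_inj l)) => /orP[|/eqP].
  by rewrite (negbTE (ordSS_neq j)).
by move/eqP; rewrite (negbTE (ordS_neq j)).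
Qed.

Lemma cycle_edges_pairs t : uniq t -> cycle_edges t \subset pairs n.
Proof.
move=> /tuple_uniqP tI; apply/fintype.subsetP => e /imsetP[i _ ->].
by rewrite inE cards2 (inj_eq tI) [i == _]eq_sym ordS_neq.
Qed.

Lemma card_cycle_edges t : uniq t -> #|cycle_edges t| = l.
Proof. by move=> tu; rewrite card_imset ?card_ord//; exact: cycle_edge_inj. Qed.

Lemma prod_cycle_edges {R : comRingType} t (F : {set 'I_n} -> R) : uniq t ->
  \prod_(e in cycle_edges t) F e =
  \prod_(i < l) F [set tnth t i; tnth t (ordS i)]%SET.
Proof.
move=> tu; rewrite big_imset//= => i j _ _; exact: cycle_edge_inj.
Qed.

Lemma cyclesP H : reflect (exists2 t : l.-tuple 'I_n, uniq t & H = cycle_edges t)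
  (H \in cycles n l).
Proof.
apply: (iffP imsetP) => -[t]; rewrite ?inE => tu ->; exists t => //.
by rewrite inE.
Qed.

Lemma card_cycles_le : (#|cycles n l| <= n ^ l)%N.
Proof.
apply: leq_trans (leq_imset_card _ _) _.
by apply: leq_trans (max_card _) _; rewrite card_tuple card_ord.
Qed.

End cycle_edges.

Section variance.
Context {R : realType} (n l : nat) (p : R).
Hypothesis l3 : (3 <= l)%N.

Let cyc H : H \in cycles n l -> H \subset pairs n /\ #|H| = l.
Proof.
by move=> /cyclesP[t tu ->]; split; [exact: cycle_edges_pairs|exact: card_cycle_edges].
Qed.

Lemma expect_ER_cycle : expect (n := n) (ER p) (signed_cycle_count l p) = 0 :> R.
Proof.
rewrite /signed_cycle_count expect_sum big1// => H /cyc[HP Hl].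
rewrite (expect_indep_sub _ (fun _ b => b%:R - p) HP).
have /card_gt0P[e eH] : (0 < #|H|)%N by rewrite Hl (leq_trans _ l3).
rewrite (bigD1 e eH) [X in X * _ = _](_ : _ = 0); last by rewrite /= ?mulr1n ?mulr0n; ring.
exact: mul0r.
Qed.

(** Distinct cycles are uncorrelated: having equally many edges, one has an edge outside the other,
    and this centred factor has mean zero. *)
Lemma variance_ER_cycle :
  Defs.variance (n := n) (ER p) (signed_cycle_count l p) = #|cycles n l|%:R * (p * (1 - p)) ^+ l :> R.
Proof.
rewrite /Defs.variance expect_ER_cycle.
transitivity (expect (n := n) (ER p) (fun G => \sum_(H in cycles n l) \sum_(H' in cycles n l)
  \prod_(e in pairs n) ((if e \in H then (e \in G)%:R - p else 1) *
                        (if e \in H' then (e \in G)%:R - p else 1)))).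
  congr expect; apply/funext => G; rewrite subr0 expr2 big_distrlr /=.
  apply: eq_bigr => H /cyc[/fintype.subsetP HP _]; apply: eq_bigr => H' /cyc[/fintype.subsetP HP' _].
  rewrite big_split /=; congr (_ * _); rewrite big_mkcond [RHS]big_mkcond;
    apply: eq_bigr => e _; do 2 case: ifP => //.
  - by move=> eP /HP; rewrite eP.
  - by move=> eP /HP'; rewrite eP.
rewrite expect_sum [RHS]mulr_natl -sumr_const.
apply: eq_bigr => H HC; have [HP Hl] := cyc HC; rewrite expect_sum.
have E H' := expect_indep_prod (fun=> p) (fun e b =>
    (if e \in H then b%:R - p else 1) * (if e \in H' then b%:R - p else 1)).
rewrite (bigD1 H)//= [X in _ + X]big1 ?addr0 => [|H' /andP[/cyc[HP' Hl'] H'H]].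
  rewrite [LHS]E (eq_bigr (fun e => if e \in H then p * (1 - p) else 1)); last first.
    by move=> e _; case: ifP => _; rewrite /= ?mulr1n ?mulr0n; ring.
  rewrite -big_mkcondr /= -Hl -prodr_const; apply: eq_bigl => e.
  by rewrite andb_idl// => /(fintype.subsetP HP).
have /subsetPn[e eH eH'] : ~~ (H \subset H').
  by apply: contra H'H => HH; rewrite eq_sym eqEcard HH Hl Hl' leqnn.
rewrite [LHS]E (bigD1 e (fintype.subsetP HP e eH)) [X in X * _ = _](_ : _ = 0); last first.
  by rewrite /= eH (negbTE eH') ?mulr1n ?mulr0n; ring.
exact: mul0r.
Qed.

End variance.

(** * Integrating kernels around a cycle *)

Section cycle_integral.
Context {R : realType} (d : nat).
Variable sigma : probability (d.-tuple R) R.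
Hypothesis sigmaU : sphere_uniform sigma.
Variables (p t : R).
Hypothesis p01 : 0 < p <= 1 / 2.
Variable n : nat.
Implicit Types (U : n.-tuple (d.-tuple R)) (x y : 'I_n) (s : seq 'I_n).

Local Notation S := (@sphere R d).
Local Notation E f := (Rintegral sigma S f).
Local Notation I f := (Rintegral (power_prob sigma n) setT f).
Local Notation wedge := (wedge p t).
Local Notation ker := (ker sigma p t).
Let mS : measurable S := @measurable_sphere R d.
Let sS : sigma S = 1%E := sigmaU.1.

Fixpoint path_prod U x s : R :=
  if s is y :: s' then wedge (tnth U x) (tnth U y) * path_prod U y s' else 1.

Lemma path_prodE U x0 x s :
  path_prod U x s = \prod_(i < size s)
    wedge (tnth U (nth x0 (x :: s) i)) (tnth U (nth x0 s i)).
Proof.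
elim: s x => [|y s IHs] x /=; first by rewrite big_ord0.
by rewrite big_ord_recl /= IHs; congr (_ * _); apply: eq_bigr => i _; case: i => [[|i] Hi].
Qed.

Lemma bmfun_tnth2 (F : d.-tuple R * d.-tuple R -> R) x y : bmfun setT F ->
  bmfun setT (fun U => F (tnth U x, tnth U y)).
Proof.
move=> bF; apply: (@bmfun_comp _ _ _ _ _ F (fun U => (tnth U x, tnth U y))) => //.
by apply/measurable_fun_pair; exact: measurable_tnth.
Qed.

Lemma bmfun_ker2 j x y : bmfun setT (fun U => ker j (tnth U x) (tnth U y)).
Proof. exact: (bmfun_tnth2 x y (bmfun_ker sigmaU p t j)). Qed.

Lemma bmfun_path_prod x s : bmfun setT (fun U => path_prod U x s).
Proof.
elim: s x => [|y s IHs] x /=; first exact: bmfun_cst.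
by apply: bmfunM => //; exact: (bmfun_ker2 0).
Qed.

Lemma path_prod_upd U x s y v : y != x -> y \notin s ->
  path_prod (upd U y v) x s = path_prod U x s.
Proof.
elim: s x => //= z s IHs x yx; rewrite inE negb_or => /andP[yz ys].
by rewrite IHs// !tnth_upd ![_ == y]eq_sym (negbTE yx) (negbTE yz).
Qed.

(** The vector of y occurs in two factors only; integrating it out merges them into the next power
    of the kernel. *)
Lemma ker_contract j x y z s : x != y -> y != z -> y \notin s ->
  I (fun U => ker j (tnth U x) (tnth U y) * path_prod U y (z :: s)) =
  I (fun U => ker j.+1 (tnth U x) (tnth U z) * path_prod U z s).
Proof.
move=> xy yz ys.
have bk : bmfun setT (fun U => ker j (tnth U x) (tnth U y) * path_prod U y (z :: s)).
  by apply: bmfunM; [exact: bmfun_ker2|exact: bmfun_path_prod].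
rewrite (Rintegral_resample sigma y bk); apply: eq_Rintegral => U _.
have bw D : bmfun D (fun v => ker j (tnth U x) v * wedge v (tnth U z)).
  by apply: bmfunM; [exact: bmfun_kerl|apply: bmfun_wedger].
rewrite -[ker j.+1 _ _ * _](ExZr mS sS (path_prod U z s) (bw S)) -(Ex_setT mS sS); last first.
  by apply: bmfunM => //; exact: bmfun_cst.
apply: eq_Rintegral => v _; rewrite /= path_prod_upd//.
by rewrite !tnth_upd eqxx (negbTE xy) [z == y]eq_sym (negbTE yz) mulrA.
Qed.

Lemma ker_path j x y s : uniq (x :: y :: s) ->
  I (fun U => ker j (tnth U x) (tnth U y) * path_prod U y (rcons s x)) =
  E (fun v => ker (j + size s).+1 v v).
Proof.
elim: s j y => [|z s IHs] j y.
  rewrite [uniq _]/= andbT inE => xy; rewrite ker_contract//; last by rewrite eq_sym.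
  transitivity (I (fun U => ker j.+1 (tnth U x) (tnth U x))).
    by apply: eq_Rintegral => U _; rewrite [path_prod _ _ _]/= mulr1.
  have bk := bmfun_ker2 j.+1 x x; rewrite (Rintegral_resample sigma x bk) addn0.
  transitivity (I (fun=> E (fun v => ker j.+1 v v))); last first.
    by apply: Ex_cst; [exact: measurableT|exact: probability_setT].
  apply: eq_Rintegral => U _.
  transitivity (Rintegral sigma setT (fun v => ker j.+1 v v)).
    by apply: eq_Rintegral => v _; rewrite tnth_upd eqxx.
  apply: (Ex_setT mS sS).
  apply: (@bmfun_comp _ _ _ _ _ (fun u => ker j.+1 u.1 u.2) (fun v => (v, v))).
    exact: measurable_fun_pair.
  exact: bmfun_ker.
rewrite rcons_cons [uniq _]/= !inE !negb_or => /and4P[/and3P[xy xz xs] /andP[yz ys] zs us].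
rewrite ker_contract//; last by rewrite mem_rcons inE negb_or eq_sym xy.
by rewrite IHs ?addSnnS//= inE negb_or xz xs zs.
Qed.

Lemma cycle_integral l (c : l.+2.-tuple 'I_n) : uniq c ->
  I (fun U => \prod_(i < l.+2) wedge (tnth U (tnth c i)) (tnth U (tnth c (ordS i)))) =
  E (fun v => ker l.+1 v v).
Proof.
case: c => -[|x [|y s]] sz //; move=> cu.
have sl : size s = l by have /eqP := sz; case.
subst l.
rewrite -(ker_path 0 cu); apply: eq_Rintegral => U _.
rewrite -[ker 0 _ _ * _]/(path_prod U x (y :: rcons s x)) (path_prodE U x).
rewrite [size (y :: _)]/= size_rcons; apply: eq_bigr => i _; rewrite !(tnth_nth x).
have il := ltn_ord i; congr (wedge (tnth U _) (tnth U _)).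
  by rewrite -!rcons_cons nth_rcons /= il.
rewrite -rcons_cons nth_rcons /=; have [li|li] := ltnP i.+1 (size s).+2.
  by rewrite modn_small//= (_ : i < (size s).+1)%N.
have {il li} e : nat_of_ord i = (size s).+1 by apply/eqP; rewrite eqn_leq -ltnS il.
by rewrite e modnn ltnn eqxx.
Qed.

End cycle_integral.

Section conditional_sums.
Context {R : realType} {dT : measure_display} {T : measurableType dT}.
Variables (P : probability T R) (D : set T).
Hypotheses (mD : measurable D) (PD : P D = 1%E).

Lemma bmfun_prod_cond (I : finType) (Q : pred I) (F : I -> T -> R) :
  (forall i, Q i -> bmfun D (F i)) -> bmfun D (fun x => \prod_(i | Q i) F i x).
Proof.
move=> bF; under eq_fun do rewrite big_mkcond.
apply: bmfun_prod => i; case: (boolP (Q i)) => [/bF//|_]; exact: bmfun_cst.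
Qed.

Lemma Ex_sum_cond (I : finType) (Q : pred I) (F : I -> T -> R) :
  (forall i, Q i -> bmfun D (F i)) ->
  \int[P]_(x in D) (\sum_(i | Q i) F i x) = \sum_(i | Q i) \int[P]_(x in D) F i x.
Proof.
move=> bF; transitivity (\int[P]_(x in D) (\sum_i (if Q i then F i x else 0))).
  by apply: eq_Rintegral => x _; rewrite big_mkcond.
rewrite (@Ex_sum _ _ _ P D mD PD _ _ (fun i x => if Q i then F i x else 0)) => [|i].
  rewrite [RHS]big_mkcond; apply: eq_bigr => i _.
  by case: (Q i) => //; exact: Ex_cst.
by case: (boolP (Q i)) => [/bF//|_]; exact: bmfun_cst.
Qed.

End conditional_sums.

(** * Expectation under the planted law *)

Section planted.
Context {R : realType} (d : nat).
Variable sigma : probability (d.-tuple R) R.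
Hypothesis sigmaU : sphere_uniform sigma.
Variables (p t k : R) (n : nat).
Implicit Types (U : n.-tuple (d.-tuple R)) (A : {set 'I_n}).

Local Notation S := (@sphere R d).
Local Notation E f := (Rintegral sigma S f).
Local Notation I f := (Rintegral (power_prob sigma n) setT f).
Local Notation wedge := (wedge p t).
Local Notation ker := (ker sigma p t).
Let PT : power_prob sigma n setT = 1%E. Proof. exact: probability_setT. Qed.

Lemma edge_prob_pair A U (a b : 'I_n) : a != b ->
  edge_prob p t A U [set a; b]%SET =
  if (a \in A) && (b \in A) then cap t (tnth U a) (tnth U b) else p.
Proof.
move=> ab; rewrite /edge_prob finset.subUset !finset.sub1set; case: ifP => // _.
rewrite /cap; congr (_%:R); congr nat_of_bool; apply/idP/idP => [|h].
  move=> /forallP/(_ a)/implyP; rewrite !inE eqxx => /(_ isT)/forallP/(_ b)/implyP.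
  by rewrite !inE eqxx orbT => /(_ isT)/implyP; apply.
apply/forallP => i; apply/implyP; rewrite !inE => hi.
apply/forallP => j; apply/implyP; rewrite !inE => hj; apply/implyP.
move: hi hj => /orP[/eqP ->|/eqP ->] /orP[/eqP ->|/eqP ->]; rewrite ?eqxx//.
by rewrite dotC.
Qed.

Lemma bmfun_edge_prob A e : e \in pairs n ->
  bmfun setT (fun U => edge_prob p t A U e).
Proof.
rewrite inE => /cards2P[a [b [ab ->]]].
rewrite (_ : (fun U => _) = fun U => if (a \in A) && (b \in A) then cap t (tnth U a) (tnth U b) else p).
  case: (_ && _); last exact: bmfun_cst.
  exact: (bmfun_tnth2 a b (@bmfun_cap2 R d t)).
by apply/funext => U; rewrite edge_prob_pair.
Qed.

Lemma bmfun_indep_edges A G :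
  bmfun setT (fun U => indep_edges (edge_prob p t A U) G).
Proof.
apply: bmfun_prod_cond => e eP; have b := bmfun_edge_prob A eP.
by case: (e \in G) => //; bmf.
Qed.

Let weight A : R := \prod_(i < n) (if i \in A then k / n%:R else 1 - k / n%:R).

Lemma expect_planted (f : {set {set 'I_n}} -> R) :
  expect (planted sigma p t k) f =
  \sum_(A : {set 'I_n}) weight A * I (fun U => expect (indep_edges (edge_prob p t A U)) f).
Proof.
rewrite /expect /planted.
under eq_bigr do rewrite mulr_suml.
rewrite exchange_big /=; apply: eq_bigr => A _.
under eq_bigr do rewrite -mulrA.
rewrite -mulr_sumr; congr (_ * _).
rewrite (Ex_sum_cond measurableT PT); last first.
  by move=> G _; apply: bmfunM; [exact: bmfun_indep_edges|exact: bmfun_cst].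
by apply: eq_bigr => G _; rewrite ExZr//; exact: bmfun_indep_edges.
Qed.

Lemma sum_weight (V : {set 'I_n}) :
  \sum_(A : {set 'I_n}) weight A * (V \subset A)%:R = (k / n%:R) ^+ #|V|.
Proof.
set q := k / n%:R.
transitivity (\prod_(i < n) (q + (if i \in V then 0 else 1 - q))).
  rewrite bigA_distr; apply: eq_bigr => A _.
  have [VA|/subsetPn[i iV iA]] := boolP (V \subset A).
    rewrite mulr1; apply: eq_bigr => i _; case: (boolP (i \in A)) => // iA.
    by rewrite ifN//; apply: contra iA; exact: fintype.subsetP.
  by rewrite mulr0 (bigD1 i)//= (negbTE iA) iV mul0r.
rewrite -prodr_const [RHS]big_mkcond; apply: eq_bigr => i _.
by case: ifP => _; [rewrite addr0|rewrite addrC subrK].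
Qed.

(** A cycle vertex outside the hidden set makes an edge factor p - p = 0. So only cycles inside it
    count, and l given vertices lie in it with probability (k / n)^l. *)
Lemma expect_planted_cycle l : (3 <= l)%N ->
  expect (planted sigma p t k) (signed_cycle_count (n := n) l p) =
  #|cycles n l|%:R * ((k / n%:R) ^+ l * E (fun v => ker l.-1 v v)).
Proof.
move=> l3; rewrite expect_planted.
transitivity (\sum_(A : {set 'I_n}) \sum_(H in cycles n l)
  weight A * I (fun U => \prod_(e in H) (edge_prob p t A U e - p))).
  apply: eq_bigr => A _; rewrite -mulr_sumr -(Ex_sum_cond measurableT PT); last first.
    move=> H /cyclesP[c cu ->]; apply: bmfun_prod_cond => e eH.
    have b := bmfun_edge_prob A (fintype.subsetP (cycle_edges_pairs l3 cu) _ eH).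
    by bmf.
  congr (_ * _); apply: eq_Rintegral => U _; rewrite /signed_cycle_count expect_sum.
  apply: eq_bigr => H /cyclesP[c cu ->].
  rewrite (expect_indep_sub _ (fun _ b => b%:R - p) (cycle_edges_pairs l3 cu)).
  by apply: eq_bigr => e _; rewrite /= ?mulr1n ?mulr0n; ring.
rewrite exchange_big /= [RHS]mulr_natl -sumr_const; apply: eq_bigr => H /cyclesP[c cu ->].
pose V : {set 'I_n} := [set x in c]%SET.
have -> : (k / n%:R) ^+ l = (k / n%:R) ^+ #|V|.
  by congr (_ ^+ _); rewrite cardsE (card_uniqP cu) size_tuple.
rewrite -sum_weight mulr_suml; apply: eq_bigr => A _; rewrite -mulrA; congr (_ * _).
have cI := tuple_uniqP _ cu.
have ne i : tnth c i != tnth c (ordS i) by rewrite (inj_eq cI) eq_sym ordS_neq.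
transitivity (I (fun U => \prod_(i < l) ((if (tnth c i \in A) && (tnth c (ordS i) \in A)
    then cap t (tnth U (tnth c i)) (tnth U (tnth c (ordS i))) else p) - p))).
  apply: eq_Rintegral => U _; rewrite prod_cycle_edges//.
  by apply: eq_bigr => i _; rewrite edge_prob_pair.
have [/fintype.subsetP VA|/subsetPn[x xV xA]] := boolP (V \subset A).
  have cA i : tnth c i \in A by apply: VA; rewrite inE mem_tnth.
  rewrite mul1r; transitivity (I (fun U => \prod_(i < l) wedge (tnth U (tnth c i)) (tnth U (tnth c (ordS i))))).
    by apply: eq_Rintegral => U _; apply: eq_bigr => i _; rewrite !cA.
  case: l l3 c cu {V VA cI ne cA} => [|[|l]]// _ c cu; exact: cycle_integral.
rewrite mul0r; transitivity (I (fun=> 0)); last exact: Ex_cst.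
apply: eq_Rintegral => U _; move: xV; rewrite inE => /tnthP[i xi].
by rewrite (bigD1 i)//= -xi (negbTE xA) subrr mul0r.
Qed.

End planted.

(** * Choice of the constants *)

Section parameters.
Context {R : realType}.

(** The m-th power of u <= exp(u) at u = b x / m. *)
Lemma exp_decay (b x : R) m : 0 < b -> 0 <= x -> (0 < m)%N ->
  expR (- (b * x)) * x ^+ m <= (m%:R / b) ^+ m.
Proof.
move=> b0 x0 m0; have mR : 0 < m%:R :> R by rewrite ltr0n.
rewrite expRN mulrC ler_pdivrMr ?expR_gt0//.
have -> : expR (b * x) = expR (b * x / m%:R) ^+ m.
  by rewrite -expRM_natl; congr expR; field; rewrite gt_eqF.
rewrite -exprMn lerXn2r ?nnegrE//; first by rewrite mulr_ge0 ?expR_ge0// divr_ge0// ltW.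
have h : b * x / m%:R <= expR (b * x / m%:R).
  by apply: le_trans (expR_ge1Dx _); rewrite lerDr.
apply: le_trans (ler_wpM2l (_ : 0 <= m%:R / b) h); last by rewrite divr_ge0// ltW.
by rewrite le_eqVlt; apply/predU1P; left; field; rewrite !gt_eqF.
Qed.

Variables (d : nat) (p c : R).
Hypothesis p01 : 0 < p <= 1 / 2.
Hypothesis c1 : 1 <= c.
Local Notation L := (ln (1 / p)).
Hypothesis dL : (5 * L) ^+ 4 <= d%:R.
Local Notation kap := (8 * c ^+ 2).
Hypothesis dkap : kap ^+ 4 <= d%:R.
Local Notation eta := (expR (- (d%:R * (1 / (c * L)) ^+ 2 / 8))).

Let L0 : 1 / 2 <= L := ln_inv_ge p01.

(** With r = sqrt d the exponent is r (r / L^2) / kap >= 25 r / kap. One r / kap is kept as decay.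
    The other 24 r / kap >= 120 L pay 2 L for the factor p^2 and, as 118 L >= 59, also 59 for the
    factor 12. *)
Lemma eta_le : 12 * eta <= p ^+ 2 * expR (- (1 / kap * Num.sqrt d%:R)).
Proof.
have L1 := L0; have c0 : 0 < c := lt_le_trans ltr01 c1; have k8 : 8 <= kap by have := exprn_ege1 2 c1; lra.
have k0 : 0 < kap by lra.
set r := Num.sqrt d%:R; have r2 : r ^+ 2 = d%:R by rewrite sqr_sqrtr.
have r0 : 0 <= r by exact: sqrtr_ge0.
have r25 : 25 * L ^+ 2 <= r.
  rewrite -(@ler_pXn2r _ 2) ?nnegrE//; last by rewrite mulr_ge0// sqr_ge0.
  rewrite r2; apply: le_trans dL; rewrite le_eqVlt; apply/predU1P; left; ring.
have r5 : 5 * kap * L <= r.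
  rewrite -(@ler_pXn2r _ 4) ?nnegrE//; last by apply: mulr_ge0; [apply: mulr_ge0|]; lra.
  rewrite (_ : r ^+ 4 = d%:R * d%:R); last by rewrite -r2; ring.
  rewrite (_ : (5 * kap * L) ^+ 4 = kap ^+ 4 * (5 * L) ^+ 4); last by ring.
  by apply: ler_pM => //; apply: exprn_ge0; [|apply: mulr_ge0]; lra.
have E : 2 * L + 59 + 1 / kap * r <= d%:R * (1 / (c * L)) ^+ 2 / 8.
  have -> : d%:R * (1 / (c * L)) ^+ 2 / 8 = r * (r / L ^+ 2) / kap.
    rewrite -r2; field; apply/andP; split; rewrite gt_eqF//; lra.
  have h1 : 25 <= r / L ^+ 2.
    by rewrite ler_pdivlMr// exprn_gt0//; lra.
  apply: (@le_trans _ _ (r * 25 / kap)); last first.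
    by rewrite ler_wpM2r ?invr_ge0 ?ler_wpM2l// ltW.
  have h2 : 5 * L <= r / kap by rewrite ler_pdivlMr//; lra.
  have -> : r * 25 / kap = 24 * (r / kap) + 1 / kap * r by ring.
  by rewrite lerD2r; lra.
have e12 : 12 * expR (- 59) <= 1 :> R.
  rewrite expRN ler_pdivrMr ?expR_gt0// mul1r.
  by apply: le_trans (expR_ge1Dx _); rewrite -natr1E /=; lra.
have := expR_ln_inv p01 2 => <-.
apply: (@le_trans _ _ (12 * (expR (- 59) * (expR (- (2 * L)) * expR (- (1 / kap * r)))))).
  by rewrite ler_pM2l// -!expRD ler_expR; lra.
by rewrite mulrA ler_piMl// mulr_ge0 ?expR_ge0.
Qed.

End parameters.

Lemma mul2n_S3 j : (2 * j.+3 = j.+1 * 2 + 4)%N.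
Proof. by lia. Qed.

Lemma sqr_le_sum {R : realFieldType} (K a X Y : R) : 0 <= a -> `|K| <= a * (X + Y) ->
  K ^+ 2 <= 2 * (a + 1) ^+ 2 * (X ^+ 2 + Y ^+ 2).
Proof.
move=> a0 KXY; rewrite -real_normK ?num_real//.
apply: (@le_trans _ _ ((a * (X + Y)) ^+ 2)).
  by rewrite lerXn2r ?nnegrE//; exact: le_trans (normr_ge0 _) KXY.
rewrite exprMn (_ : 2 * (a + 1) ^+ 2 * (X ^+ 2 + Y ^+ 2) =
  (a + 1) ^+ 2 * (2 * (X ^+ 2 + Y ^+ 2))); last by ring.
apply: ler_pM; [exact: sqr_ge0|exact: sqr_ge0|by rewrite lerXn2r ?nnegrE//; lra|].
by have := sqr_ge0 (X - Y); lra.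
Qed.

Section diagonal.
Context {R : realType}.

(** Stated for the square, since th^(l - 2) alone contains a half-integer power of d. Here l = j +
    3, and d0 is fixed before j. *)
Lemma Ex_ker_diag_le : exists d0 : nat, forall j, exists2 C : R, 0 < C &
  forall (d : nat) (sigma : probability (d.-tuple R) R) (p t : R),
  sphere_uniform sigma -> 0 < p <= 1 / 2 -> is_threshold sigma p t ->
  (d0 <= d)%N -> (5 * ln (1 / p)) ^+ 4 <= d%:R ->
  (\int[sigma]_(v in @sphere R d) ker sigma p t j.+2 v v) ^+ 2 * d%:R ^+ j.+1 <=
    C * (p ^+ (2 * j.+3) * ln (1 / p) ^+ j.+3).
Proof.
(* The constant required by [dlL] for dl = 1 / (c L). *)
pose c : R := 4800; have c1 : 1 <= c by rewrite /c ler1n.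
have cE : c = 4800 by []; move: c c1 cE => c c1 cE.
pose kap := 8 * c ^+ 2; have kap8 : 8 <= kap by rewrite /kap; have := exprn_ege1 2 c1; lra.
have kap0 : 0 < kap by lra.
exists (Num.bound (kap ^+ 4)) => j.
pose m := (2 * j.+1)%N.
(* [exp_decay] for exp(- (2 / kap) r) r^m at r = sqrt d, where r^m = d^(j + 1). *)
pose D : R := (m%:R / (2 / kap)) ^+ m.
have D0 : 0 <= D by rewrite exprn_ge0// divr_ge0// divr_ge0//; lra.
exists (2 * (lip_const j.+1 + 1) ^+ 2 * (1 + 2 ^+ j.+3 * D)).
  have := lip_const_ge j.+1 (R := R) => l0.
  apply: mulr_gt0; first by apply: mulr_gt0 => //; apply: exprn_gt0; rewrite ltr_pwDr.
  by rewrite ltr_pwDl//; apply: mulr_ge0 => //; exact: exprn_ge0.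
move=> d sigma p t sigmaU p01 pt dd0 dL.
have dkap : kap ^+ 4 <= d%:R.
  apply: (@le_trans _ _ (Num.bound (kap ^+ 4))%:R); last by rewrite ler_nat.
  by apply/ltW/archi_boundP/exprn_ge0; lra.
have d2 : (2 <= d)%N.
  have : (2%:R : R) <= d%:R; last by rewrite ler_nat.
  apply: le_trans dkap; have k1 : 1 <= kap by lra.
  rewrite exprS; have := exprn_ege1 3 k1; set q := kap ^+ 3 => q1.
  by have := ler_pM (_ : 0 <= 8) ler01 kap8 q1; lra.
have L0 := ln_inv_ge p01; set L := ln (1 / p) in L0 dL *.
have Lp : 0 < L by lra.
have L2' : 1 <= 2 * L by lra.
have /andP[p0 p2] := p01.
pose dl := 1 / (c * L).
have cL0 : 0 < c * L by rewrite mulr_gt0//; lra.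
have dl0 : 0 < dl by rewrite divr_gt0.
have dl2 : dl <= 1 / 2.
  rewrite /dl ler_pM2l// lef_pV2 ?posrE//; rewrite cE; lra.
have dlL : 4800 * L * dl <= 1.
  by rewrite -cE /dl mulrA mulr1 divff// gt_eqF.
have := eta_le p01 c1 dL dkap; rewrite -/L -/kap -/dl; set eta := expR _ => eta_e.
have e1 : expR (- (1 / kap * Num.sqrt d%:R)) <= 1 :> R.
  by rewrite -[leRHS](@expR0 R) ler_expR oppr_le0 mulr_ge0 ?sqrtr_ge0// divr_ge0// ltW.
have etap : 12 * eta <= p ^+ 2.
  by apply: le_trans eta_e _; rewrite ler_piMr// sqr_ge0.
have eta0 : 0 <= eta by exact: expR_ge0.
set K := Rintegral _ _ _.
have mS := @measurable_sphere R d; have sS := sigmaU.1.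
set th := Num.sqrt (L / d%:R).
set l1 := lip_const j.+1; have l0 : 0 <= l1 := lip_const_ge j.+1.
have K_le : `|K| <= l1 * (L * p ^+ j.+3 * th ^+ j.+1 + p ^+ j.+1 * eta).
  have bk : bmfun (@sphere R d) (fun v => ker sigma p t j.+2 v v).
    apply: (@bmfun_comp _ _ _ _ _ (fun u => ker sigma p t j.+2 u.1 u.2) (fun v => (v, v))).
      exact: measurable_fun_pair.
    exact: bmfun_ker.
  apply: le_trans (Ex_norm mS sS bk) _; apply: (Ex_le_cst mS sS); first exact: bmfun_norm.
  by move=> v v1; apply: (ker_diag_le sigmaU d2 p01 pt dl0 dl2 dlL etap).
set X := L * p ^+ j.+3 * th ^+ j.+1 in K_le; set Y := p ^+ j.+1 * eta in K_le.
have K2 : K ^+ 2 <= 2 * (l1 + 1) ^+ 2 * (X ^+ 2 + Y ^+ 2).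
  exact: sqr_le_sum.
have dR : 0 < d%:R :> R by rewrite ltr0n ltnW.
have thd : th ^+ 2 * d%:R = L by rewrite sqr_sqrtr ?divfK ?gt_eqF// divr_ge0// ltW.
have X2 : X ^+ 2 * d%:R ^+ j.+1 = p ^+ (2 * j.+3) * L ^+ j.+3.
  have a : (p ^+ j.+3) ^+ 2 = p ^+ (2 * j.+3) by rewrite -exprM mulnC.
  have b : (th ^+ j.+1) ^+ 2 * d%:R ^+ j.+1 = L ^+ j.+1 by rewrite exprAC -exprMn thd.
  have -> : X ^+ 2 = L ^+ 2 * (p ^+ j.+3) ^+ 2 * (th ^+ j.+1) ^+ 2.
    by rewrite /X exprMn [(L * _) ^+ 2]exprMn.
  rewrite a -mulrA b (_ : L ^+ j.+3 = L ^+ 2 * L ^+ j.+1); last by rewrite -exprD.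
  by rewrite mulrA [p ^+ _ * _]mulrC.
have Y2 : Y ^+ 2 * d%:R ^+ j.+1 <= 2 ^+ j.+3 * D * (p ^+ (2 * j.+3) * L ^+ j.+3).
  set r := Num.sqrt d%:R in eta_e.
  have r2 : d%:R = r ^+ 2 by rewrite sqr_sqrtr.
  have e2 : eta ^+ 2 <= p ^+ 4 * expR (- (2 / kap * r)).
    have -> : p ^+ 4 * expR (- (2 / kap * r)) = (p ^+ 2 * expR (- (1 / kap * r))) ^+ 2.
      rewrite exprMn -[(p ^+ 2) ^+ 2]exprM; congr (_ * _).
      by rewrite -expRM_natl; congr expR; ring.
    have pe0 : 0 <= p ^+ 2 * expR (- (1 / kap * r)) by rewrite mulr_ge0 ?sqr_ge0 ?expR_ge0.
    by rewrite lerXn2r ?nnegrE//; apply: le_trans eta_e; rewrite ler_peMl// ler1n.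
  have dec : expR (- (2 / kap * r)) * r ^+ m <= D.
    by apply: exp_decay; rewrite ?sqrtr_ge0// divr_gt0.
  (* L >= 1/2 supplies the power of L that the bound on Y lacks. *)
  have L2 : 1 <= 2 ^+ j.+3 * L ^+ j.+3.
    by rewrite -exprMn exprn_ege1.
  have pp : p ^+ (2 * j.+3) = p ^+ (j.+1 * 2) * p ^+ 4.
    by rewrite -exprD mul2n_S3.
  have pj : 0 <= p ^+ (j.+1 * 2) by rewrite exprn_ge0// ltW.
  have p4 : 0 <= p ^+ 4 by rewrite exprn_ge0// ltW.
  have -> : Y ^+ 2 * d%:R ^+ j.+1 = p ^+ (j.+1 * 2) * (eta ^+ 2 * r ^+ m).
    by rewrite /Y exprMn -exprM r2 -exprM mulrA.
  have -> : 2 ^+ j.+3 * D * (p ^+ (2 * j.+3) * L ^+ j.+3) =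
     p ^+ (j.+1 * 2) * (p ^+ 4 * D * (2 ^+ j.+3 * L ^+ j.+3)) by rewrite pp; ring.
  rewrite ler_wpM2l//.
  apply: (@le_trans _ _ (p ^+ 4 * D)); last by rewrite ler_peMr// mulr_ge0.
  apply: (@le_trans _ _ (p ^+ 4 * expR (- (2 / kap * r)) * r ^+ m)).
    by rewrite ler_wpM2r// exprn_ge0// sqrtr_ge0.
  by rewrite -mulrA ler_wpM2l.
have dj : 0 <= d%:R ^+ j.+1 :> R by rewrite exprn_ge0.
apply: le_trans (ler_wpM2r dj K2) _.
rewrite -[leLHS]mulrA -[leRHS]mulrA; apply: ler_wpM2l.
  by apply: mulr_ge0 => //; exact: sqr_ge0.
by rewrite [leLHS]mulrDl X2 mulrDl mul1r lerD2l.
Qed.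

End diagonal.

(** The variance under the null law is at least N (p / 2)^l, as 1 - p >= 1/2. Of the N^2 in the
    squared expectation, one N goes to the variance and the other is bounded by n^l. *)
Lemma separation_arith {R : realFieldType} (N k n p L K C D b2 : R) (l : nat) :
  0 <= N <= n ^+ l -> 0 < n -> 0 < p <= 1 / 2 -> 0 <= L -> 0 <= C ->
  K ^+ 2 * D <= C * (p ^+ (2 * l) * L ^+ l) -> N * (p * (1 - p)) ^+ l <= b2 ->
  D * (N * ((k / n) ^+ l * K)) ^+ 2 <= 2 ^+ l * C * (k ^+ 2 * p * L / n) ^+ l * b2.
Proof.
move=> /andP[N0 Nn] n0 /andP[p0 p2] L0 C0 KD hb.
have q0 : 0 <= (k / n) ^+ l ^+ 2 by exact: sqr_ge0.
have L0l : 0 <= L ^+ l by exact: exprn_ge0.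
have p0l : 0 <= p ^+ l by apply/exprn_ge0/ltW.
have -> : D * (N * ((k / n) ^+ l * K)) ^+ 2 = N ^+ 2 * (k / n) ^+ l ^+ 2 * (K ^+ 2 * D) by ring.
apply: le_trans (ler_wpM2l (mulr_ge0 (sqr_ge0 N) q0) KD) _.
have X : (k ^+ 2 * p * L / n) ^+ l = (k / n) ^+ l ^+ 2 * p ^+ l * L ^+ l * n ^+ l.
  rewrite -exprM mulnC exprM -!exprMn; congr (_ ^+ _); field; by rewrite gt_eqF.
have b2_ge : N * (p / 2) ^+ l <= b2.
  apply: le_trans hb; rewrite ler_wpM2l// lerXn2r ?nnegrE//; last by nra.
  - by rewrite divr_ge0// ltW.
  - by nra.
have pl : p ^+ (2 * l) = p ^+ l * p ^+ l by rewrite mul2n -addnn exprD.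
have M0 : 0 <= 2 ^+ l * C * (k ^+ 2 * p * L / n) ^+ l.
  rewrite X; have n0l : 0 <= n ^+ l by apply/exprn_ge0/ltW.
  apply: mulr_ge0; first by apply: mulr_ge0 => //; exact: exprn_ge0.
  by do 3? [apply: mulr_ge0 => //].
apply: le_trans (ler_wpM2l M0 b2_ge).
have two : 2 ^+ l * (p / 2) ^+ l = p ^+ l by rewrite -exprMn; congr (_ ^+ _); field.
rewrite X (_ : 2 ^+ l * C * _ * _ = C * (k / n) ^+ l ^+ 2 * p ^+ l * L ^+ l * N *
  (2 ^+ l * (p / 2) ^+ l) * n ^+ l); last by ring.
rewrite two pl (_ : N ^+ 2 * _ * _ = C * (k / n) ^+ l ^+ 2 * p ^+ l * L ^+ l * N * p ^+ l * N); last by ring.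
by apply: ler_wpM2l => //; do 5? [apply: mulr_ge0 => //].
Qed.

Theorem proposition2p10 (R : realType) :
  exists d0 : nat, forall l : nat, (3 <= l)%N ->
  forall (p : nat -> R) (d : nat -> nat) (k : nat -> R)
    (sigma : forall n : nat, probability ((d n).-tuple R) R) (tau : nat -> R),
    (forall n, 0 < p n <= 1 / 2) ->
    (forall n, 0 <= k n <= n%:R) ->
    k n @[n --> \oo] --> +oo ->
    (forall n, (d0 <= d n)%N) ->
    (forall n, (5 * ln (1 / p n)) ^+ 4 <= (d n)%:R) ->
    (forall n, sphere_uniform (sigma n)) ->
    (forall n, is_threshold (sigma n) (p n) (tau n)) ->
    strong_separation
      (fun n => planted (sigma n) (p n) (tau n) (k n))
      (fun n => ER (p n))
      (fun n => signed_cycle_count l (p n)) ->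
    much_less
      (fun n => (d n)%:R)
      (fun n => (k n ^+ 2 * p n * ln (1 / p n) / n%:R)
                  `^ (l%:R / (l%:R - 2))).
Proof.
have [d0 Hd0] := @Ex_ker_diag_le R; exists d0 => -[|[|[|j]]]// l3.
move=> p d k sigma tau p01 kn koo dd0 dL sU st [aN0 ba0].
have [C C0 HC] := Hd0 j; set l := j.+3 in l3 aN0 ba0 *.
pose X n : R := k n ^+ 2 * p n * ln (1 / p n) / n%:R.
pose al : R := l%:R / (l%:R - 2).
have L0 n : 0 < ln (1 / p n) by apply: lt_le_trans (ln_inv_ge (p01 n)); lra.
have p0 n : 0 < p n by case/andP: (p01 n).
have kpos : \forall n \near \oo, 0 < k n by move/cvgryPgt: koo; apply.
have Xpos : \forall n \near \oo, 0 < n%:R :> R /\ 0 < X n.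
  near=> n; have k0 : 0 < k n by near: n.
  have n0 : 0 < n%:R :> R by case/andP: (kn n) => _; exact: lt_le_trans.
  by split => //; rewrite /X divr_gt0// !mulr_gt0// exprn_gt0.
(* al (l - 2) = l: the power j + 1 = l - 2 removes the real exponent from the claim. *)
have powX n : 0 < X n -> (X n `^ al) ^+ j.+1 = X n ^+ l.
  move=> X0; rewrite -powR_mulrn ?powR_ge0// -powRrM -powR_mulrn ?ltW//; congr (_ `^ _).
  have lE : l%:R - 2 = j.+1%:R :> R by rewrite /l -addn2 natrD addrK.
  by rewrite /al lE divfK.
split; first by apply: filterS Xpos => n [_ X0]; rewrite gt_eqF// powR_gt0.
apply/cvgr0Pnorm_lt => eps eps0.
pose M := 2 ^+ l * C.
have M0 : 0 < M by rewrite mulr_gt0// exprn_gt0.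
(* As (d / X^al)^(l - 2) <= M (b / a)^2, a ratio |b / a| below e' brings d / X^al below eps. *)
pose e' := Num.sqrt (eps ^+ j.+1 / M).
have e'0 : 0 < e' by rewrite sqrtr_gt0 divr_gt0// exprn_gt0.
have e'2 : M * e' ^+ 2 = eps ^+ j.+1.
  rewrite sqr_sqrtr; last by rewrite divr_ge0 ?exprn_ge0// ltW.
  by rewrite mulrC divfK// gt_eqF.
move/cvgr0Pnorm_lt: ba0 => /(_ _ e'0) ba.
apply: filterS3 Xpos aN0 ba => n [n0 X0] /=.
set b := Num.max _ _; rewrite expect_ER_cycle// subr0 expect_planted_cycle//.
set K := Rintegral _ _ _; set N := #|_|%:R; set a := N * _ => a_n0 ba_lt.
have b2 : N * (p n * (1 - p n)) ^+ l <= b ^+ 2.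
  rewrite -variance_ER_cycle//; set V := Defs.variance _ _.
  have V0 : 0 <= V.
    rewrite /V variance_ER_cycle// mulr_ge0 ?exprn_ge0// mulr_ge0 ?ltW//.
    by case/andP: (p01 n) => *; lra.
  rewrite -[leLHS](sqr_sqrtr V0) lerXn2r ?nnegrE ?sqrtr_ge0//.
    by rewrite le_max sqrtr_ge0.
  by rewrite le_max lexx.
have N01 : 0 <= N <= n%:R ^+ l by rewrite /N ler0n -natrX ler_nat card_cycles_le.
have KD := HC (d n) (sigma n) (p n) (tau n) (sU n) (p01 n) (st n) (dd0 n) (dL n).
have main : (d n)%:R ^+ j.+1 * a ^+ 2 <= M * X n ^+ l * b ^+ 2.
  exact: (separation_arith (k n) N01 n0 (p01 n) (ltW (L0 n)) (ltW C0) KD b2).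
have r0 : 0 <= (d n)%:R / X n `^ al by rewrite divr_ge0// powR_ge0.
rewrite ger0_norm// -(@ltr_pXn2r _ j.+1)// ?nnegrE ?(ltW eps0)//.
rewrite expr_div_n powX//.
have a2 : 0 < a ^+ 2 by rewrite lt_neqAle sqr_ge0 eq_sym sqrf_eq0 a_n0.
have Xl : 0 < X n ^+ l by exact: exprn_gt0.
rewrite ltr_pdivrMr// -(ltr_pM2r a2); apply: le_lt_trans main _.
have : (b / a) ^+ 2 < e' ^+ 2.
  by rewrite -real_normK ?num_real// ltr_pXn2r ?nnegrE// ltW.
rewrite expr_div_n ltr_pdivrMr// => b2a2.
have H : M * b ^+ 2 < eps ^+ j.+1 * a ^+ 2 by rewrite -e'2 -[ltRHS]mulrA ltr_pM2l.
have -> : M * X n ^+ l * b ^+ 2 = M * b ^+ 2 * X n ^+ l by rewrite mulrAC.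
have -> : eps ^+ j.+1 * X n ^+ l * a ^+ 2 = eps ^+ j.+1 * a ^+ 2 * X n ^+ l by rewrite mulrAC.
by rewrite ltr_pM2r.
Unshelve. all: by end_near.
Qed.
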